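(* For $N=1,2,\ldots$ let $a^{(N)}$ and $b^{(N)}$ be finite multisets of positive integers of the same size such that \[ f_N(q)=\frac{\prod_{a\in a^{(N)}}[a]_q}{\prod_{b\in b^{(N)}}[b]_q} \] is a basic cyclotomic generating function, and let $\mathcal{X}_N$ be a random variable with $\mathbb{E}[q^{\mathcal{X}_N}]=f_N(q)/f_N(1)$. If \[ \limsup_{N\to\infty}\frac{\sum_{b\in b^{(N)}}(b^2-1)}{\sum_{a\in a^{(N)}}(a^2-1)}<1 \quad\text{and}\quad \lim_{N\to\infty}\sum_{a\in a^{(N)}}\left(\frac{a}{\max a^{(N)}}\right)^4=\infty, \] then the sequence $\mathcal{X}_1,\mathcal{X}_2,\ldots$ is asymptotically normal.
   Context: $[n]_q:=1+q+\cdots+q^{n-1}$. A basic cyclotomic generating function is a polynomial with nonnegative integer coefficients of the form $\prod_{j=1}^m [a_j]_q/[b_j]_q$ for multisets $\{a_j\},\{b_j\}$ of positive integers. For a real random variable $\mathcal{X}$ with mean $\mu$ and variance $\sigma^2>0$, its standardization is $\mathcal{X}^*=(\mathcal{X}-\mu)/\sigma$. A sequence $\mathcal{X}_1,\mathcal{X}_2,\ldots$ is asymptotically normal if $\mathcal{X}_N^*$ converges in distribution to the standard normal distribution $\mathcal{N}(0,1)$.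
   Formalization: Adds the hypothesis that for all large N the number 1 does not lie in both a^(N) and b^(N) (common trivial factors [1]_q cancelled); without it the claim fails, e.g. a={2,1^N}, b={1^(N+1)}, where f_N=1+q and X_N is Bernoulli(1/2) for every N. *)

(* Defs.v *)
From HB Require Import structures.
From mathcomp Require Import all_boot all_order all_algebra.
From mathcomp Require Import finmap multiset.
From mathcomp Require Import all_classical all_reals all_analysis.

Set Implicit Arguments.
Unset Strict Implicit.
Unset Printing Implicit Defensive.

Import Order.TTheory GRing.Theory Num.Theory.
Import numFieldNormedType.Exports.

Local Open Scope classical_set_scope.
Local Open Scope ring_scope.

Definition qint (n : nat) : {poly int} := \sum_(i < n) 'X^i.

(* [{poly int}] is an integral domain and each [qint b] with [0 < b] is
   nonzero, so the third clause says exactly that [f] is the quotient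
   [\prod_(x <- a) qint x / \prod_(x <- b) qint x]. *)
Definition basic_cgf (a b : {mset nat}%mset) (f : {poly int}) : Prop :=
  [/\ all (fun x => 0 < x)%N a && all (fun x => 0 < x)%N b,
      size a = size b,
      f * (\prod_(x <- b) qint x) = \prod_(x <- a) qint x
    & forall i : nat, 0 <= f`_i].

Definition poly_eval (R : realType) (f : {poly int}) (q : R) : R :=
  (map_poly intr f).[q].

(* The generating-function identity E[q^X] = f(q)/f(1), for every real q > 0.
   [X] is real-valued and not assumed integer-valued: this is a consequence
   (almost surely). *)
Definition has_gen_fun (R : realType) (d : measure_display)
    (T : measurableType d) (P : probability T R) (X : {RV P >-> R})
    (f : {poly int}) : Prop :=
  forall q : R, 0 < q ->
    ('E_P[fun w => (q `^ X w)%R] = (poly_eval f q / poly_eval f 1)%:E)%E.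

Definition standardize (R : realType) (d : measure_display)
    (T : measurableType d) (P : probability T R) (X : {RV P >-> R}) : T -> R :=
  fun w => (X w - fine 'E_P[X]) / Num.sqrt (fine 'V_P[X]).

(* Convergence of the distribution functions at every continuity point of the
   limit; the variables may live on different probability spaces. *)
Definition cvg_in_distribution (R : realType) (d : nat -> measure_display)
    (T : forall N, measurableType (d N)) (P : forall N, probability (T N) R)
    (Y : forall N, T N -> R) (mu : probability (measurableTypeR R) R) : Prop :=
  forall x : R, {for x, continuous (fun t : R => mu `]-oo, t]%classic)} ->
    P N [set w | Y N w <= x] @[N --> \oo] --> mu `]-oo, x]%classic.

(* The first clause ensures that [fine], [Num.sqrt] and the division in
   [standardize] are not applied to degenerate arguments. *)
Definition asymptotically_normal (R : realType) (d : nat -> measure_display)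
    (T : forall N, measurableType (d N)) (P : forall N, probability (T N) R)
    (X : forall N, {RV (P N) >-> R}) : Prop :=
  (\forall N \near \oo, (0 < 'V_(P N)[X N] < +oo)%E) /\
  cvg_in_distribution P (fun N => standardize (X N)) (normal_prob 0 1).

(* Main.v *)
(* E[q^X_N] is a ratio of products of [n]_q, so E[e^(t X_N)] is a ratio of
   moment generating functions of uniform variables on {0, ..., n-1}, each of
   which is e^(t(n-1)/2) exp(t^2 (n^2-1)/24 + O((t n)^4)) for |t| n <= 1/2.
   Denominator entries are at most max a^(N), by evaluation at roots of unity.
   Hence Var X_N = (sum (a^2-1) - sum (b^2-1))/12, the hypotheses force
   (max a^(N))^2 = o(Var X_N), and the mgf of the standardization tends
   pointwise to e^(t^2/2).

   Convergence of the mgfs implies convergence in distribution (Curtiss) by a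
   real-variable argument: functions m such that multiplication by m preserves
   convergence of all exponentially tilted integrals form an algebra that
   contains e^(ty) and is closed under limits with error eps * e^(S|y|).
   It contains y, the limit of (e^(hy)-1)/h, and sin(ty+c), by its Taylor
   series, hence the bounded polynomials in sin(ty+c) that approximate the
   indicator of a half-line. *)
Require Import Defs.
From HB Require Import structures.
From mathcomp Require Import all_boot all_order all_algebra.
From mathcomp Require Import finmap multiset.
From mathcomp Require Import all_classical all_reals all_analysis.
From mathcomp Require Import algC cyclotomic measurable_realfun.
From mathcomp Require Import zify ring lra.

Set Implicit Arguments.
Unset Strict Implicit.
Unset Printing Implicit Defensive.

Import Order.TTheory GRing.Theory Num.Theory.
Import numFieldNormedType.Exports.

Local Open Scope classical_set_scope.
Local Open Scope ring_scope.

(** * Taylor remainders of [expR] and [sin], and Bernoulli's inequality *)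

Section elementary.
Context {R : realType}.
Implicit Types x y z : R.

(** The quotient of [(n + k)!] by [n! * k!] is a binomial coefficient, hence at least 1. *)
Lemma exp_coeffD_le x (n k : nat) : 0 <= x ->
  exp_coeff x (n + k)%N <= exp_coeff x n * exp_coeff x k.
Proof.
move=> x0; rewrite /exp_coeff /= exprD mulrACA -invfM.
apply: ler_wpM2l; first by rewrite mulr_ge0 ?exprn_ge0.
rewrite lef_pV2 ?posrE ?mulr_gt0 ?ltr0n ?fact_gt0// -natrM ler_nat.
have /(bin_fact) := leq_addr k n; rewrite addKn => <-.
by rewrite leq_pmull// bin_gt0 leq_addr.
Qed.

Lemma series_exp_coeff_le x n : 0 <= x -> series (exp_coeff x) n <= expR x.
Proof.
move=> x0; apply: nondecreasing_cvgn_le.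
  apply/nondecreasing_seqP => m.
  by rewrite /series /= big_nat_recr//= lerDl exp_coeff_ge0.
exact: is_cvg_series_exp_coeff.
Qed.

Lemma exp_coeff_le_expR x n : 0 <= x -> exp_coeff x n <= expR x.
Proof.
move=> x0; apply: (le_trans _ (series_exp_coeff_le n.+1 x0)).
by rewrite /series /= big_nat_recr//= lerDr sumr_ge0// => i _; rewrite exp_coeff_ge0.
Qed.

Lemma exp_dominated_remainder (u : R^nat) z n :
    (forall k, `|u k| <= exp_coeff `|z| k) ->
  `|limn (series u) - series u n| <= exp_coeff `|z| n * expR `|z|.
Proof.
move=> uz.
have cu : cvgn (series u).
  apply: normed_cvg; apply: series_le_cvg uz _ => //.
    by move=> k; rewrite exp_coeff_ge0.
  exact: is_cvg_series_exp_coeff.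
have cd : (fun m => `|series u m - series u n|) @ \oo
    --> `|limn (series u) - series u n|.
  by apply: cvg_norm; apply: cvgB => //; exact: cvg_cst.
apply: (cvgr_to_le cd); exists n => // m /= nm.
rewrite sub_series_geq//; apply: (le_trans (ler_norm_sum _ _ _)).
rewrite -{1}[n]add0n -{1}(subnK nm) big_addn.
apply: (@le_trans _ _
    (\sum_(0 <= i < m - n) exp_coeff `|z| n * exp_coeff `|z| i)).
  rewrite addnK.
  apply: ler_sum => i _; rewrite (le_trans (uz _))// addnC.
  exact: exp_coeffD_le.
rewrite -mulr_sumr; apply: ler_wpM2l; first by rewrite exp_coeff_ge0.
exact: series_exp_coeff_le.
Qed.

Lemma expR_remainder z n :
  `|expR z - series (exp_coeff z) n| <= exp_coeff `|z| n * expR `|z|.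
Proof.
apply: exp_dominated_remainder => k.
by rewrite /exp_coeff /= normrM normfV normrX normr_nat.
Qed.

Lemma expR_remainder2 z : `|expR z - 1 - z| <= z ^+ 2 * expR `|z|.
Proof.
have := expR_remainder z 2.
rewrite /series /exp_coeff /= !big_nat_recr//= big_geq// add0r expr0 expr1 !divr1.
rewrite opprD addrA => /le_trans; apply; rewrite ler_pM2r ?expR_gt0//.
rewrite real_normK ?num_real//; have := sqr_ge0 z; move: (z ^+ 2) => u; rewrite (_ : 2`! = 2)%N//; lra.
Qed.

(** Odd powers cancel between [z] and [- z], so two cubic Taylor expansions leave an error of order
    four, at most [2 / 24] of the stated bound. *)
Lemma expR_addN_remainder z :
  `|expR z + expR (- z) - 2 - z ^+ 2| <= z ^+ 4 * expR `|z|.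
Proof.
have z4 : 0 <= z ^+ 4 by rewrite (_ : z ^+ 4 = (z ^+ 2) ^+ 2) ?sqr_ge0// -exprM.
have h w : `|w| = `|z| ->
    `|expR w - (1 + w + w ^+ 2 / 2 + w ^+ 3 / 6)| <= z ^+ 4 * expR `|z| / 24.
  move=> wz; have := expR_remainder w 4; rewrite wz.
  rewrite /series /exp_coeff /= !big_nat_recr//= big_geq// add0r expr0 expr1 !divr1.
  rewrite (_ : 2`! = 2)%N// (_ : 3`! = 6)%N// => /le_trans; apply.
  by rewrite (_ : 4`! = 24)%N// -normrX ger0_norm// mulrAC.
have e0 := expR_ge0 `|z|.
have := h z erefl; have := h (- z); rewrite normrN => /(_ erefl).
have := mulr_ge0 z4 e0; move: (z ^+ 4 * _) => u u0.
rewrite !ler_norml => /andP[h1 h2] /andP[h3 h4].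
by apply/andP; split; lra.
Qed.

(** Writing [|z|^n / n!] as [2^-n (2|z|)^n / n!] and bounding the last factor by [e^(2|z|)] gives an
    error that tends to 0 with [n], with a fixed exponential weight valid for all [z]. *)
Lemma sin_remainder z n :
  `|sin z - series (sin_coeff z) n| <= 2 ^- n * expR (3 * `|z|).
Proof.
rewrite unlock; apply: (le_trans (exp_dominated_remainder (z := z) _ _)).
  move=> k; rewrite /exp_coeff /sin_coeff /=.
  rewrite !normrM normfV !normr_nat !normrX normrN normr1 expr1n mulr1.
  case: odd; [by rewrite mul1r| by rewrite !mul0r divr_ge0].
rewrite (_ : 3 * `|z| = 2 * `|z| + `|z|); last by ring.
rewrite expRD mulrA; apply: ler_wpM2r => //.
rewrite mulrC ler_pdivlMr ?exprn_gt0//.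
rewrite (_ : _ * 2 ^+ n = exp_coeff (2 * `|z|) n); last first.
  by rewrite /exp_coeff /= exprMn; ring.
by apply: exp_coeff_le_expR; rewrite mulr_ge0.
Qed.

Lemma bernoulli_ineq x n : -1 <= x -> 1 + n%:R * x <= (1 + x) ^+ n.
Proof.
move=> x1; elim: n => [|n ih]; first by rewrite mul0r addr0 expr0.
rewrite exprS; apply: (@le_trans _ _ ((1 + x) * (1 + n%:R * x))); last first.
  by apply: ler_wpM2l => //; lra.
rewrite -natr1; have : 0 <= n%:R * x ^+ 2 by rewrite mulr_ge0 ?sqr_ge0.
lra.
Qed.

End elementary.

(** * Functions of at most exponential growth and their integrability *)

Section exponential_moments.
Context {R : realType}.
Implicit Types (mu : probability (measurableTypeR R) R) (g h m : R -> R).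

Definition exp_bounded g := measurable_fun setT g /\
  exists C S : R, [/\ 0 <= C, 0 <= S & forall y, `|g y| <= C * expR (S * `|y|)].

Definition has_exp_moments mu :=
  forall s : R, mu.-integrable setT (EFin \o (fun y : R => expR (s * y))).

Lemma expR_norm_le (s y : R) :
  expR (s * `|y|) <= expR (s * y) + expR (- s * y).
Proof.
have [y0|y0] := leP 0 y; first by rewrite ger0_norm// lerDl expR_ge0.
by rewrite ltr0_norm// mulrN mulNr lerDr expR_ge0.
Qed.

Lemma expR_le_norm (s y : R) : expR (s * y) <= expR (`|s| * `|y|).
Proof. by rewrite ler_expR -normrM ler_norm. Qed.

Lemma measurable_expRM (s : R) : measurable_fun setT (fun y : R => expR (s * y)).
Proof. by apply: measurableT_comp => //; exact: measurable_funM. Qed.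

Lemma exp_bounded_integrable mu g : has_exp_moments mu -> exp_bounded g ->
  mu.-integrable setT (EFin \o g).
Proof.
move=> hmu [mg [C [S [C0 S0 gb]]]].
apply: (@le_integrable _ _ _ mu setT measurableT _
  (EFin \o (fun y : R => C * (expR (S * y) + expR (- S * y))))).
- exact/measurable_EFinP.
- move=> y _ /=; rewrite lee_fin (le_trans (gb y))//.
  rewrite [leRHS]ger0_norm ?mulr_ge0 ?addr_ge0 ?expR_ge0//.
  by apply: ler_wpM2l => //; exact: expR_norm_le.
- rewrite (_ : EFin \o _ = (fun y : R => C%:E *
    (((EFin \o (fun z : R => expR (S * z))) \+
    (EFin \o (fun z : R => expR (- S * z)))) y))%E).
    by apply: integrableZl => //; apply: integrableD.
  by apply/funext => y /=; rewrite EFinM EFinD.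
Qed.

Lemma exp_bounded_expR (s : R) : exp_bounded (fun y => expR (s * y)).
Proof.
split; first exact: measurable_expRM.
exists 1, `|s|; split => // y; rewrite mul1r ger0_norm ?expR_ge0//.
exact: expR_le_norm.
Qed.

Lemma exp_boundedM g h : exp_bounded g -> exp_bounded h ->
  exp_bounded (fun y => g y * h y).
Proof.
move=> [mg [C [S [C0 S0 gb]]]] [mh [D [T [D0 T0 hb]]]].
split; first exact: measurable_funM.
exists (C * D), (S + T); split; [exact: mulr_ge0|exact: addr_ge0|].
move=> y; rewrite normrM mulrDl expRD mulrACA.
by apply: ler_pM.
Qed.

Lemma exp_boundedZ g c : exp_bounded g -> exp_bounded (fun y => c * g y).
Proof.
move=> [mg [C [S [C0 S0 gb]]]]; split; first exact: measurable_funM.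
exists (`|c| * C), S; split => //; first exact: mulr_ge0.
by move=> y; rewrite normrM -mulrA ler_wpM2l.
Qed.

Lemma exp_boundedD g h : exp_bounded g -> exp_bounded h ->
  exp_bounded (fun y => g y + h y).
Proof.
move=> [mg [C [S [C0 S0 gb]]]] [mh [D [T [D0 T0 hb]]]].
split; first exact: measurable_funD.
exists (C + D), (S + T); split; [exact: addr_ge0|exact: addr_ge0|].
move=> y; rewrite (le_trans (ler_normD _ _))// mulrDl; apply: lerD.
  rewrite (le_trans (gb y))// ler_wpM2l// ler_expR mulrDl lerDl mulr_ge0//.
rewrite (le_trans (hb y))// ler_wpM2l// ler_expR mulrDl lerDr mulr_ge0//.
Qed.

Lemma exp_bounded_near (m m' : R -> R) (e S : R) : 0 <= e -> 0 <= S ->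
    measurable_fun setT m -> exp_bounded m' ->
    (forall y, `|m y - m' y| <= e * expR (S * `|y|)) ->
  exp_bounded m.
Proof.
move=> e0 S0 mm m'b mm'.
have [mm1 _] := m'b.
have db : exp_bounded (fun y => m y - m' y).
  by split; [exact: measurable_funB | exists e, S].
have [_ h] := exp_boundedD db m'b.
split => //; move: h => [C [T [C0 T0 h]]]; exists C, T; split => // y.
by have := h y; rewrite subrK.
Qed.

End exponential_moments.

(** * The algebra of multipliers *)

Section multipliers.
Context {R : realType}.
Variables (nu_ : nat -> probability (measurableTypeR R) R)
  (nu : probability (measurableTypeR R) R).
Hypothesis nu_exp : forall n, has_exp_moments (nu_ n).
Hypothesis nuexp : has_exp_moments nu.
Hypothesis mgf_cvg : forall s : R,
  \int[nu_ n]_y expR (s * y) @[n --> \oo] --> \int[nu]_y expR (s * y).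
Implicit Types (g h m : R -> R).

Definition integral_cvg g := \int[nu_ n]_y g y @[n --> \oo] --> \int[nu]_y g y.

Definition tilt_cvg g :=
  exp_bounded g /\ forall s : R, integral_cvg (fun y => expR (s * y) * g y).

(** Phrased as an operator on [tilt_cvg], the property is stable under products by mere composition;
    convergence of integrals alone is not. *)
Definition multiplier m := forall g, tilt_cvg g -> tilt_cvg (fun y => m y * g y).

Lemma integral_cvgD g h : exp_bounded g -> exp_bounded h ->
  integral_cvg g -> integral_cvg h -> integral_cvg (fun y => g y + h y).
Proof.
move=> gb hb cg ch; rewrite /integral_cvg.
rewrite RintegralD//; try exact: exp_bounded_integrable.
under eq_fun => n do rewrite (RintegralD measurableT
  (exp_bounded_integrable (nu_exp n) gb) (exp_bounded_integrable (nu_exp n) hb)).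
exact: cvgD.
Qed.

Lemma integral_cvgZ g c : exp_bounded g ->
  integral_cvg g -> integral_cvg (fun y => c * g y).
Proof.
move=> gb cg; rewrite /integral_cvg.
rewrite RintegralZl//; try exact: exp_bounded_integrable.
under eq_fun => n do rewrite (RintegralZl _ measurableT
  (exp_bounded_integrable (nu_exp n) gb)).
by apply: cvgM => //; exact: cvg_cst.
Qed.

(** Since [e^(S|y|) <= e^(Sy) + e^(-Sy)], the error is controlled by two values of the moment
    generating function, whose convergence is assumed. *)
Lemma Rintegral_near mu g h (e S : R) : has_exp_moments mu ->
    exp_bounded g -> exp_bounded h ->
    (forall y, `|g y - h y| <= e * expR (S * `|y|)) -> 0 <= e ->
  `|\int[mu]_y g y - \int[mu]_y h y| <=
    e * (\int[mu]_y expR (S * y) + \int[mu]_y expR (- S * y)).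
Proof.
move=> hmu gb hb gh e0.
have nhb : exp_bounded (fun y => - h y).
  by have := exp_boundedZ (-1) hb; under eq_fun do rewrite mulN1r.
have ghb := exp_boundedD gb nhb.
rewrite -RintegralB//; try exact: exp_bounded_integrable.
apply: (le_trans (le_normr_Rintegral _ _)) => //.
  exact: exp_bounded_integrable.
rewrite -RintegralD//; try exact: hmu.
have eb : exp_bounded (fun y => expR (S * y) + expR (- S * y)).
  by apply: exp_boundedD; exact: exp_bounded_expR.
rewrite -RintegralZl//; last exact: exp_bounded_integrable.
apply: le_Rintegral => //.
- exact: (integrable_norm (exp_bounded_integrable hmu ghb)).
- by apply: exp_bounded_integrable => //; exact: exp_boundedZ.
- move=> y _; apply: (le_trans (gh y)); apply: ler_wpM2l => //.
  exact: expR_norm_le.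
Qed.

Lemma integral_cvg_near g (S : R) : exp_bounded g ->
    (forall e, 0 < e -> exists h, [/\ exp_bounded h, integral_cvg h &
      forall y, `|g y - h y| <= e * expR (S * `|y|)]) ->
  integral_cvg g.
Proof.
move=> gb H; apply/cvgrPdist_le => /= e e0.
pose K (mu : probability (measurableTypeR R) R) :=
  \int[mu]_y expR (S * y) + \int[mu]_y expR (- S * y).
have cK : K (nu_ n) @[n --> \oo] --> K nu by apply: cvgD.
have K0 : 0 <= K nu by apply: addr_ge0; apply: Rintegral_ge0.
(* Eventually [K (nu_ n) <= K nu + 1], so replacing [g] by [h] costs at most [e / 3] under [nu] and
   under [nu_ n]; the last third is the convergence for [h]. *)
have d0 : 0 < e / (3 * (K nu + 1)) by rewrite divr_gt0// mulr_gt0//; lra.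
have [h [hb ch gh]] := H _ d0.
set d := e / _ in d0 gh.
have hd : d * (K nu + 1) = e / 3.
  by rewrite /d; field; lra.
have /cvgrPdist_le/(_ (e / 3)) : integral_cvg h by [].
rewrite divr_gt0// => /(_ isT) h1.
have /cvgrPdist_le/(_ 1 ltr01) h2 := cK.
near=> n.
have := Rintegral_near nuexp gb hb gh (ltW d0).
have := Rintegral_near (nu_exp n) gb hb gh (ltW d0).
rewrite -!/(K _).
have : `|\int[nu]_y h y - \int[nu_ n]_y h y| <= e / 3 by near: n.
have : `|K nu - K (nu_ n)| <= 1 by near: n.
move=> /ler_normlP[k1 k2] /ler_normlP[a1 a2] /ler_normlP[b1 b2] /ler_normlP[c1 c2].
have e1 : d * K (nu_ n) <= e / 3.
  by rewrite -hd; apply: ler_wpM2l; [exact: ltW | lra].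
have e2 : d * K nu <= e / 3.
  by rewrite -hd; apply: ler_wpM2l; [exact: ltW | lra].
by apply/ler_normlP; split; lra.
Unshelve. all: by end_near.
Qed.

Lemma multiplier_expR (t : R) : multiplier (fun y => expR (t * y)).
Proof.
move=> g [gb cg]; split; first by apply: exp_boundedM => //; exact: exp_bounded_expR.
by move=> s; under eq_fun do rewrite mulrA -expRD -mulrDl; exact: cg.
Qed.

Lemma multiplierM m1 m2 : multiplier m1 -> multiplier m2 ->
  multiplier (fun y => m1 y * m2 y).
Proof.
move=> h1 h2 g cg; have := h1 _ (h2 _ cg).
by under eq_fun do rewrite mulrA.
Qed.

Lemma multiplierD m1 m2 : multiplier m1 -> multiplier m2 ->
  multiplier (fun y => m1 y + m2 y).
Proof.
move=> h1 h2 g cg; have [b1 c1] := h1 _ cg; have [b2 c2] := h2 _ cg.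
under eq_fun do rewrite mulrDl; split; first exact: exp_boundedD.
move=> s; under eq_fun do rewrite mulrDr.
by apply: integral_cvgD; rewrite ?c1 ?c2//; apply: exp_boundedM => //;
  exact: exp_bounded_expR.
Qed.

Lemma multiplier_cst (c : R) : multiplier (fun=> c).
Proof.
move=> g [gb cg]; split; first exact: exp_boundedZ.
move=> s; under eq_fun do rewrite mulrCA.
by apply: integral_cvgZ => //; apply: exp_boundedM => //; exact: exp_bounded_expR.
Qed.

Lemma multiplierX m k : multiplier m -> multiplier (fun y => m y ^+ k).
Proof.
move=> mm; elim: k => [|k ih]; first exact: multiplier_cst.
by under eq_fun do rewrite exprS; exact: multiplierM.
Qed.

Lemma multiplier_sum (F : nat -> R -> R) k : (forall i, multiplier (F i)) ->
  multiplier (fun y => \sum_(0 <= i < k) F i y).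
Proof.
move=> mF; elim: k => [|k ih].
  by under eq_fun do rewrite big_geq//; exact: multiplier_cst.
by under eq_fun do rewrite big_nat_recr//=; exact: multiplierD.
Qed.

Lemma tilt_cvg1 : tilt_cvg (fun=> 1).
Proof.
split; first by have := exp_bounded_expR (0 : R);
  under eq_fun do rewrite mul0r expR0.
by move=> s; under eq_fun do rewrite mulr1; exact: mgf_cvg.
Qed.

Lemma multiplier_tilt_cvg m : multiplier m -> tilt_cvg m.
Proof. by move=> /(_ _ tilt_cvg1); under eq_fun do rewrite mulr1. Qed.

Lemma multiplier_exp_bounded m : multiplier m -> exp_bounded m.
Proof. by move=> /multiplier_tilt_cvg[]. Qed.

Lemma multiplier_integral_cvg m : multiplier m -> integral_cvg m.
Proof.
by move=> /multiplier_tilt_cvg[_ /(_ 0)]; under eq_fun do rewrite mul0r expR0 mul1r.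
Qed.

(** If [|g y| <= C e^(T|y|)], then replacing [m] by [m'] in [e^(sy) m g] costs at most [e] times the
    weight of rate [|s| + S + T], once [m'] has accuracy [e / (C + 1)]; the added 1 allows
    [C = 0]. *)
Lemma multiplier_near m (S : R) : measurable_fun setT m -> 0 <= S ->
    (forall e, 0 < e -> exists2 m', multiplier m' &
      forall y, `|m y - m' y| <= e * expR (S * `|y|)) ->
  multiplier m.
Proof.
move=> mm S0 H.
have mb : exp_bounded m.
  have [m' mm' mm1] := H 1 ltr01.
  by apply: (exp_bounded_near _ _ mm _ mm1) => //; exact: multiplier_exp_bounded.
move=> g [gb cg]; split; first exact: exp_boundedM.
move=> s; have [mg [C [T [C0 T0 gT]]]] := gb.
apply: (@integral_cvg_near _ (`|s| + (S + T))).
  by apply: exp_boundedM; [exact: exp_bounded_expR|exact: exp_boundedM].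
move=> e e0; have d0 : 0 < e / (C + 1) by rewrite divr_gt0//; lra.
have [m' mm' mm1] := H _ d0.
exists (fun y => expR (s * y) * (m' y * g y)); split.
- apply: exp_boundedM; first exact: exp_bounded_expR.
  by apply: exp_boundedM => //; exact: multiplier_exp_bounded.
- by have [_] := mm' g (conj gb cg).
- move=> y; rewrite -mulrBr -mulrBl !normrM (ger0_norm (expR_ge0 _)).
  rewrite !mulrDl !expRD [leRHS]mulrCA; apply: ler_pM => //.
  - exact: expR_le_norm.
  rewrite mulrA; apply: (@le_trans _ _ ((e / (C + 1) * expR (S * `|y|)) *
    (C * expR (T * `|y|)))).
    by apply: ler_pM.
  rewrite mulrACA -[leRHS]mulrA; apply: ler_wpM2r.
    by rewrite mulr_ge0 ?expR_ge0.
  by rewrite mulrAC ler_pdivrMr; [nra|lra].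
Qed.

Lemma multiplier_id : multiplier id.
Proof.
apply: (@multiplier_near _ 3) => // e e0.
(* The step of the difference quotient: [d <= e] gives the accuracy and [d <= 1] gives
   [e^|dy| <= e^|y|]. The rate 3 absorbs this factor and [y^2 <= e^(2|y|)]. *)
pose d := Num.min e 1.
have d0 : 0 < d by rewrite lt_min e0 ltr01.
have d1 : d <= 1 by rewrite ge_min lexx orbT.
have de : d <= e by rewrite ge_min lexx.
exists (fun y => d^-1 * (expR (d * y) + -1)).
  apply: multiplierM; first exact: multiplier_cst.
  by apply: multiplierD; [exact: multiplier_expR|exact: multiplier_cst].
move=> y.
have -> : y - d^-1 * (expR (d * y) + -1) = - (d^-1 * (expR (d * y) - 1 - d * y)).
  by field; lra.
rewrite normrN normrM ger0_norm ?invr_ge0 ?(ltW d0)// mulrC ler_pdivrMr//.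
apply: (le_trans (expR_remainder2 _)).
rewrite (_ : 3 * `|y| = 2 * `|y| + `|y|); last by ring.
have u0 := sqr_ge0 y.
have uy : y ^+ 2 <= expR (2 * `|y|).
  have := @exp_coeff_le_expR R (2 * `|y|) 2; rewrite mulr_ge0// => /(_ isT).
  rewrite /exp_coeff /= exprMn real_normK ?num_real// (_ : 2`! = 2)%N//.
  by lra.
rewrite expRD [leRHS]mulrC exprMn (expr2 d); move: (y ^+ 2) u0 uy => u u0 uy.
rewrite -!mulrA; apply: ler_wpM2l; first exact: ltW.
apply: ler_pM => //; first exact: ltW.
  by rewrite mulr_ge0 ?expR_ge0.
apply: ler_pM; rewrite ?expR_ge0//.
by rewrite ler_expR normrM gtr0_norm// ler_piMl.
Qed.

(** Taylor polynomials in [t * y + c] are multipliers. The remainder is at most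
    [2^-n e^(3|c|) e^(3|t||y|)], whose constant is made small by [n] while the rate [3|t|] stays
    fixed. *)
Lemma multiplier_sin (t c : R) : multiplier (fun y => sin (t * y + c)).
Proof.
have mlin : multiplier (fun y => t * y + c).
  apply: multiplierD; last exact: multiplier_cst.
  by apply: multiplierM; [exact: multiplier_cst|exact: multiplier_id].
apply: (@multiplier_near _ (3 * `|t|)).
- have [? _] := multiplier_exp_bounded mlin.
  by apply: measurableT_comp => //; apply: continuous_measurable_fun;
    exact: continuous_sin.
- by rewrite mulr_ge0.
move=> e e0.
have [n hn] : exists n, 2 ^- n * expR (3 * `|c|) <= e.
  have /cvgrPdist_le/(_ (e / expR (3 * `|c|))) :=
    @cvg_geometric R 1 2^-1 ltac:(rewrite ger0_norm; lra).
  rewrite divr_gt0 ?expR_gt0// => /(_ isT)[n _ /(_ n)/=]; rewrite leqnn.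
  move=> /(_ isT); rewrite sub0r normrN mul1r ger0_norm ?exprn_ge0//.
  by rewrite ler_pdivlMr ?expR_gt0// exprVn; exists n.
exists (fun y => series (sin_coeff (t * y + c)) n).
  apply: multiplier_sum => i.
  rewrite /sin_coeff /=.
  under eq_fun do rewrite mulrAC; apply: multiplierM; last exact: multiplierX.
  exact: multiplier_cst.
move=> y; apply: (le_trans (sin_remainder _ _)).
apply: (@le_trans _ _ (2 ^- n * (expR (3 * `|c|) * expR (3 * `|t| * `|y|)))).
  apply: ler_wpM2l; first by rewrite invr_ge0 exprn_ge0.
  rewrite -expRD ler_expR -mulrA -mulrDr ler_wpM2l// addrC -normrM.
  exact: ler_normD.
by rewrite mulrA; apply: ler_wpM2r => //; exact: expR_ge0.
Qed.

End multipliers.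

(** * Bounded trigonometric approximations of the indicator of a half-line *)

Section step_functions.
Context {R : realType}.
Implicit Types v x y e t : R.

(** Both nontrivial bounds come from Bernoulli's inequality: directly for the lower one, and for the
    last one through [(2v)^n <= (1 + v^n)^(2^n)] and [(1 - v^n)(1 + v^n) <= 1]. *)
Lemma step_bounds v n : 0 <= v <= 1 ->
  [/\ 0 <= (1 - v ^+ n) ^+ (2 ^ n), (1 - v ^+ n) ^+ (2 ^ n) <= 1,
      1 - (2 * v) ^+ n <= (1 - v ^+ n) ^+ (2 ^ n) &
      (1 - v ^+ n) ^+ (2 ^ n) * (2 * v) ^+ n <= 1].
Proof.
move=> /andP[v0 v1].
have u0 : 0 <= v ^+ n by rewrite exprn_ge0.
have u1 : v ^+ n <= 1 by rewrite exprn_ile1.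
have k0 : 0 <= 1 - v ^+ n by lra.
have g0 : 0 <= (1 - v ^+ n) ^+ (2 ^ n) by rewrite exprn_ge0.
have twoE : (2 * v) ^+ n = (2 ^ n)%:R * v ^+ n by rewrite exprMn natrX.
split => //.
- by rewrite exprn_ile1//; lra.
- rewrite twoE -mulrN; apply: bernoulli_ineq; lra.
- apply: (@le_trans _ _ ((1 - v ^+ n) ^+ (2 ^ n) * (1 + v ^+ n) ^+ (2 ^ n))).
    apply: ler_wpM2l => //; rewrite twoE.
    by apply: (le_trans _ (bernoulli_ineq _ _)); lra.
  by rewrite -exprMn -subr_sqr expr1n exprn_ile1//; nra.
Qed.

Lemma sin_nondecreasing : {in `[(-1 : R), 1] &, {homo sin : x y / x <= y}}.
Proof.
move=> x y; rewrite !in_itv/= => /andP[x0 x1] /andP[y0 y1].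
rewrite le_eqVlt => /predU1P[->//|xy].
have p2 := pi_ge2 R.
by rewrite ltW// ltr_sin// in_itv/=; apply/andP; split; lra.
Qed.

Lemma exprn_small (z e : R) : 0 <= z < 1 -> 0 < e ->
  \forall n \near \oo, z ^+ n <= e.
Proof.
move=> /andP[z0 z1] e0.
have /cvgrPdist_le/(_ _ e0) := @cvg_geometric R 1 z ltac:(by rewrite ger0_norm).
apply: filterS => n; rewrite /geometric /= sub0r normrN mul1r.
by rewrite ger0_norm// exprn_ge0.
Qed.

(* [(1 - v ^+ n) ^+ (2 ^ n)] is close to [1] for [v < 1/2] and to [0] for
   [v > 1/2]; the substitution [v = (1 + sin (t * (y - c))) / 2] keeps it
   bounded on the whole line. *)
Lemma sin_step (x eta e : R) : 0 < eta -> 0 < e ->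
  exists t c n, forall y, let g := (1 - (2^-1 * (1 + sin (t * y + c))) ^+ n) ^+ (2 ^ n) in
    (y <= x)%R%:R - e * (expR (1 * y) + expR (- 1 * y)) <= g /\
    g <= (y <= x + eta)%R%:R + e * (expR (1 * y) + expR (- 1 * y)).
Proof.
move=> eta0 e0.
(* The sine is centred at the midpoint of the transition interval from [x] to [x + eta]. Beyond
   [|y| = L] the error term [e * e^|y|] already exceeds 1. *)
pose c := x + eta / 2; pose L := e^-1.
have L0 : 0 < L by rewrite invr_gt0.
have D0 : 0 < L + `|c| + 1 + eta by have := normr_ge0 c; lra.
(* This frequency keeps [t * (y - c)] in [[-1, 1]] for [|y| <= L], where the sine is monotone. *)
pose t := (L + `|c| + 1 + eta)^-1.
have t0 : 0 < t by rewrite invr_gt0.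
have tD : t * (L + `|c| + 1 + eta) = 1 by rewrite mulVf// gt_eqF.
have c0 := normr_ge0 c.
have te : 0 < t * eta by rewrite mulr_gt0.
have tL : 0 < t * L by rewrite mulr_gt0.
have tc : 0 <= t * `|c| by rewrite mulr_ge0// ltW.
have te1 : t * eta <= 1 by nra.
(* At the ends of the transition interval the sine equals [- d] and [d], so [2 * v] is at most
   [1 - d] to its left and at least [1 + d] to its right. *)
pose d := sin (t * eta / 2).
have d0 : 0 < d by rewrite sin2_gt0//; apply/andP; split; lra.
have d1 : d <= 1 by exact: sin_le1.
have h1 := @exprn_small (1 - d) e ltac:(apply/andP; split; lra) e0.
have h2 : \forall n \near \oo, ((1 + d)^-1) ^+ n <= e.
  apply: exprn_small => //; rewrite invr_ge0 invf_lt1; last lra.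
  by apply/andP; split; lra.
have [n [hn1 hn2]] : exists n, (1 - d) ^+ n <= e /\ ((1 + d)^-1) ^+ n <= e.
  near \oo => n; exists n; split; near: n => //.
exists t, (- (t * c)), n => y /=.
rewrite -mulrBr; set s := sin _; set v := 2^-1 * _; set W := expR _ + _.
have s1 : s <= 1 by exact: sin_le1.
have sN1 : -1 <= s by exact: sin_geN1.
have v01 : 0 <= v <= 1 by rewrite /v; apply/andP; split; lra.
have [g0 g1 g2 g3] := step_bounds n v01.
have W1 : expR `|y| <= W by have := expR_norm_le 1 y; rewrite mul1r.
have W2 : 1 <= expR `|y| by rewrite -expR0 ler_expR.
(* For [|y| > L] the error term is at least 1, and the values in [[0, 1]] of the step function
   satisfy both inequalities trivially. *)
have [yL|yL] := lerP `|y| L; last first.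
  have : 1 <= e * W.
    rewrite -ler_pdivrMl// mulr1 (le_trans _ W1)//.
    apply: (le_trans _ (ltW (expR_gt1Dx _))); last by rewrite gt_eqF// (lt_trans L0).
    by rewrite -/L; lra.
  move: g0 g1; set g := _ ^+ _; clear.
  by case: (y <= x); case: (y <= x + eta) => /=; lra.
have eW : e <= e * W by rewrite ler_peMr//; [exact: ltW | lra].
have [yN yP] : - L <= y /\ y <= L by apply/andP; rewrite -ler_norml.
have [cN cP] : - `|c| <= c /\ c <= `|c| by apply/andP; rewrite -ler_norml.
have b1 : t * (y - c) <= 1 by nra.
have b2 : -1 <= t * (y - c) by nra.
split.
- have [yx|yx] := boolP (y <= x); last by rewrite /= sub0r; move: g0; set g := _ ^+ _; lra.
  have sd : s <= - d.
    rewrite /d -sinN; apply: sin_nondecreasing; rewrite ?in_itv/=.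
    + by rewrite b1 b2.
    + by apply/andP; split; move: te te1; clear; lra.
    + have : t * (y - x) <= 0 by rewrite pmulr_rle0//; lra.
      rewrite /c; lra.
  have : (2 * v) ^+ n <= (1 - d) ^+ n.
    by apply: lerXn2r; rewrite ?nnegrE /v; move: sd d0 d1 s1 sN1; clear; lra.
  by move: g2 hn1; rewrite /=; lra.
- have [yx|yx] := boolP (y <= x + eta); first by rewrite /=; move: g1; set g := _ ^+ _; lra.
  rewrite -ltNge in yx.
  have sd : d <= s.
    apply: sin_nondecreasing; rewrite ?in_itv/=.
    + by apply/andP; split; move: te te1; clear; lra.
    + by rewrite b1 b2.
    + have : 0 <= t * (y - (x + eta)) by rewrite pmulr_rge0//; lra.
      rewrite /c; lra.
  have dv : (1 + d) ^+ n <= (2 * v) ^+ n.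
    by apply: lerXn2r; rewrite ?nnegrE /v; move: sd d0 d1 s1 sN1; clear; lra.
  have dn0 : 0 < (1 + d) ^+ n by rewrite exprn_gt0//; lra.
  rewrite /= add0r (le_trans _ eW)// (le_trans _ hn2)// exprVn.
  rewrite -[leRHS]mul1r ler_pdivlMr// (le_trans _ g3)//.
  by apply: ler_wpM2l.
Unshelve. all: by end_near.
Qed.

End step_functions.

(** * From moment generating functions to distribution functions *)

Section mgf_continuity.
Context {R : realType}.
Variables (nu_ : nat -> probability (measurableTypeR R) R)
  (nu : probability (measurableTypeR R) R).
Hypothesis nu_exp : forall n, has_exp_moments (nu_ n).
Hypothesis nuexp : has_exp_moments nu.
Hypothesis mgf_cvg : forall s : R,
  \int[nu_ n]_y expR (s * y) @[n --> \oo] --> \int[nu]_y expR (s * y).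

Let W (y : R) := expR (1 * y) + expR (- 1 * y).

Lemma multiplier_step (t c : R) n :
  multiplier nu_ nu (fun y => (1 - (2^-1 * (1 + sin (t * y + c))) ^+ n) ^+ (2 ^ n)).
Proof.
apply: multiplierX => //.
under eq_fun do rewrite -mulN1r.
apply: multiplierD => //; first exact: multiplier_cst.
apply: multiplierM => //; first exact: multiplier_cst.
apply: multiplierX => //; apply: multiplierM => //; first exact: multiplier_cst.
by apply: multiplierD => //; [exact: multiplier_cst|exact: multiplier_sin].
Qed.

Let indic_ray (x : R) :
  (fun y : R => (y <= x)%R%:R) = \1_(`]-oo, x]%classic) :> (R -> R).
Proof.
apply/funext => y; rewrite indicE.
by rewrite (_ : (y \in _) = (y <= x)%R)//; apply/idP/idP; rewrite inE/= in_itv.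
Qed.

Let cdf_Rintegral (mu : probability (measurableTypeR R) R) (x : R) :
  mu `]-oo, x]%classic = (\int[mu]_y (y <= x)%R%:R)%:E.
Proof.
rewrite indic_ray /Rintegral integral_indic// setIT fineK//.
exact: fin_num_measure.
Qed.

Let exp_bounded_le (x : R) : exp_bounded (fun y : R => (y <= x)%R%:R).
Proof.
split.
  by rewrite indic_ray; exact: measurable_indic.
exists 1, 0; split => // y.
by rewrite mul0r expR0 mulr1; case: (y <= x); rewrite ?normr1 ?normr0.
Qed.

(** Approximate steps descending on [[x, x + eta]] and on [[x - eta, x]] bound the distribution
    functions of [nu_ n] at [x] from above and below by those of [nu] at [x + eta] and [x - eta];
    continuity at [x] closes the gap. *)
Lemma mgf_cvg_cdf (x : R) :
  {for x, continuous (fun t : R => nu `]-oo, t]%classic)} ->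
  nu_ n `]-oo, x]%classic @[n --> \oo] --> nu `]-oo, x]%classic.
Proof.
pose F (mu : probability (measurableTypeR R) R) z := \int[mu]_y (y <= z)%R%:R.
move=> cx; rewrite cdf_Rintegral; under eq_fun do rewrite cdf_Rintegral.
apply: cvg_EFin; first exact: nearW.
have {}cx : {for x, continuous (F nu)}.
  have : (fun t => nu `]-oo, t]%classic) @ x --> (F nu x)%:E by rewrite -cdf_Rintegral.
  by move/fine_cvg; apply: cvg_trans; apply: near_eq_cvg; apply: nearW => y;
    rewrite /= cdf_Rintegral.
have Wb : exp_bounded W by apply: exp_boundedD; exact: exp_bounded_expR.
have cW : integral_cvg nu_ nu W.
  by apply: integral_cvgD => //; try exact: exp_bounded_expR; exact: mgf_cvg.
pose K := \int[nu]_y W y.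
have K0 : 0 <= K by apply: Rintegral_ge0 => y _; rewrite addr_ge0 ?expR_ge0.
apply/cvgrPdist_le => /= e e0.
have e4 : 0 < e / 4 by lra.
have [eta eta0 heta] : exists2 eta : R, 0 < eta &
    forall y, `|x - y| <= eta -> `|F nu x - F nu y| <= e / 4.
  have /cvgrPdist_le/(_ _ e4)/nbhs_ballP[eta /= eta0 H] := cx.
  exists (eta / 2); first by lra.
  by move=> y xy; apply: H; rewrite /ball/= (le_lt_trans xy)//; lra.
(* The weight [W] then costs at most [e / 8] under [nu] and, eventually, under [nu_ n]; with [e / 4]
   for the convergence for [g] this makes the [e / 2] below. *)
pose d := e / (8 * (K + 1)).
have d0 : 0 < d by rewrite divr_gt0// mulr_gt0//; lra.
have dK : d * (K + 1) = e / 8 by rewrite /d; field; lra.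
have bound (lo hi : R) : hi = lo + eta -> \forall n \near \oo,
    F (nu_ n) lo <= F nu hi + e / 2 /\ F nu lo - e / 2 <= F (nu_ n) hi.
  move=> hiE; have [t [c [n0 H]]] := sin_step lo eta0 d0.
  pose g y := (1 - (2^-1 * (1 + sin (t * y + c))) ^+ n0) ^+ (2 ^ n0).
  have mg : multiplier nu_ nu g by exact: multiplier_step.
  have gb : exp_bounded g by exact: multiplier_exp_bounded mg.
  have cg : integral_cvg nu_ nu g by exact: multiplier_integral_cvg mg.
  have sandwich (mu : probability (measurableTypeR R) R) : has_exp_moments mu ->
      F mu lo <= \int[mu]_y g y + d * \int[mu]_y W y /\
      \int[mu]_y g y <= F mu hi + d * \int[mu]_y W y.
    move=> hmu.
    have dWb := exp_boundedZ d Wb.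
    rewrite -RintegralZl//; last exact: exp_bounded_integrable.
    rewrite -!RintegralD//; try exact: exp_bounded_integrable.
    split; apply: le_Rintegral => //; try exact: exp_bounded_integrable;
      try (by apply: exp_bounded_integrable => //; exact: exp_boundedD);
      move=> y _; have [h1 h2] := H y; last by rewrite hiE.
    by rewrite -lerBlDr.
  have /cvgrPdist_le/(_ 1 ltr01) nW := cW.
  have /cvgrPdist_le/(_ _ e4) ng := cg.
  near=> n.
  have : `|K - \int[nu_ n]_y W y| <= 1 by near: n.
  have : `|\int[nu]_y g y - \int[nu_ n]_y g y| <= e / 4 by near: n.
  have [] := sandwich _ nuexp; have [] := sandwich _ (nu_exp n).
  rewrite -/K => a1 a2 b1 b2 /ler_normlP[g1 g2] /ler_normlP[k1 k2].
  have dKn : d * (\int[nu_ n]_y W y) <= d * (K + 1).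
    by apply: ler_wpM2l; [exact: ltW|lra].
  have dKK : d * K <= d * (K + 1) by apply: ler_wpM2l; [exact: ltW|rewrite lerDl].
  by split; lra.
have bu := bound x (x + eta) erefl.
have bl := bound (x - eta) x ltac:(by rewrite subrK).
have := heta (x + eta); rewrite opprD addNKr normrN (gtr0_norm eta0) => /(_ (lexx _)).
have := heta (x - eta); rewrite opprB subrKC (gtr0_norm eta0) => /(_ (lexx _)).
move=> /ler_normlP[c1 c2] /ler_normlP[c3 c4].
near=> n.
have [bu1 _] : F (nu_ n) x <= F nu (x + eta) + e / 2 /\
  F nu x - e / 2 <= F (nu_ n) (x + eta) by near: n.
have [_ bl1] : F (nu_ n) (x - eta) <= F nu x + e / 2 /\
  F nu (x - eta) - e / 2 <= F (nu_ n) x by near: n.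
rewrite /F in bu1 bl1 c1 c2 c3 c4 *.
by apply/ler_normlP; split; lra.
Unshelve. all: by end_near.
Qed.

End mgf_continuity.

(** * Push-forward laws and further functions of exponential growth *)

Section laws.
Context {R : realType}.
Implicit Types (g : R -> R).

Lemma exp_bounded_shift g (c : R) : exp_bounded g -> exp_bounded (fun y => g (y - c)).
Proof.
move=> [mg [C [S [C0 S0 gb]]]]; split.
  by apply: measurableT_comp => //; exact: measurable_funB.
exists (C * expR (S * `|c|)), S; split => //; first by rewrite mulr_ge0 ?expR_ge0.
move=> y; rewrite (le_trans (gb _))// -mulrA ler_wpM2l// -expRD ler_expR -mulrDr.
by rewrite ler_wpM2l// [leRHS]addrC ler_normB.
Qed.

Lemma exp_bounded_norm_expR : exp_bounded (fun y : R => expR `|y|).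
Proof.
split; first exact: measurableT_comp.
by exists 1, 1; split => // y; rewrite !mul1r ger0_norm ?expR_ge0.
Qed.

Lemma exp_bounded_id : exp_bounded (fun y : R => y).
Proof.
split => //; exists 1, 1; split => // y; rewrite !mul1r.
by apply: (le_trans _ (expR_ge1Dx _)); lra.
Qed.

Lemma exp_boundedX g k : exp_bounded g -> exp_bounded (fun y => g y ^+ k).
Proof.
move=> gb; elim: k => [|k ih].
  have -> : (fun y => g y ^+ 0) = (fun y => expR (0 * y)).
    by apply/funext => y; rewrite mul0r expR0.
  exact: exp_bounded_expR.
by under eq_fun do rewrite exprS; exact: exp_boundedM.
Qed.

Lemma exp_bounded_cst (c : R) : exp_bounded (fun=> c).
Proof.
split => //; exists `|c|, 0; split => // y.
by rewrite mul0r expR0 mulr1.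
Qed.

End laws.

Section law.
Context {R : realType} d (T : measurableType d) (P : probability T R) (X : T -> R).
Hypothesis mX : measurable_fun setT X.

(* [R] and [measurableTypeR R] carry the same measurable sets but are
   different measurable types; [normal_prob] lives on the latter. *)
Let X' : T -> measurableTypeR R := X.
Let mX' : measurable_fun setT X'. Proof. exact: mX. Qed.
HB.instance Definition _ := @isMeasurableFun.Build _ _ _ _ X' mX'.
Definition law : probability (measurableTypeR R) R := distribution P X'.

Lemma integral_law (g : R -> R) : measurable_fun setT g -> (forall y, 0 <= g y) ->
  (\int[law]_y (g y)%:E = 'E_P[fun w => g (X w)])%E.
Proof.
move=> mg g0; rewrite unlock ge0_integral_distribution//.
exact/measurable_EFinP.
Qed.

End law.

(** * Mean and variance read off from the expansion of a moment generating function *)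

Lemma eq0_of_small (R : realType) (x C e : R) : 0 < e ->
  (forall h, 0 < h -> h <= e -> `|x| <= C * h) -> x = 0.
Proof.
move=> e0 H; apply/eqP; rewrite -normr_eq0 eq_le normr_ge0 andbT.
apply/ler_addgt0Pl => r r0; rewrite addr0.
pose h := Num.min e (r / (`|C| + 1)).
have C1 : 0 < `|C| + 1 by have := normr_ge0 C; lra.
have h0 : 0 < h by rewrite lt_min e0 divr_gt0.
have := H h h0; rewrite ge_min lexx => /(_ isT) /le_trans; apply.
apply: (@le_trans _ _ ((`|C| + 1) * h)).
  by apply: ler_wpM2r; [exact: ltW | have := ler_norm C; lra].
by rewrite mulrC -ler_pdivlMr// ge_min lexx orbT.
Qed.

Section mgf.
Context {R : realType} d (T : measurableType d) (P : probability T R) (X : T -> R).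
Hypothesis mX : measurable_fun setT X.
Local Notation law := (law P mX).
Implicit Types (g : R -> R).

Variable M : R -> R.
Hypothesis hM : forall t : R, ('E_P[fun w => expR (t * X w)%R] = (M t)%:E)%E.

Lemma law_has_exp_moments : has_exp_moments law.
Proof.
move=> s; apply/integrableP; split.
  by apply/measurable_EFinP; exact: measurable_expRM.
under eq_integral do rewrite /= ger0_norm ?expR_ge0//.
rewrite integral_law ?hM ?ltry//.
exact: measurable_expRM.
Qed.

Lemma Rintegral_law_expR s : \int[law]_y expR (s * y) = M s.
Proof.
rewrite /Rintegral integral_law ?hM//.
exact: measurable_expRM.
Qed.

Lemma expectation_law g : exp_bounded g ->
  ('E_P[fun w => g (X w)] = (\int[law]_y g y)%:E)%E.
Proof.
move=> gb; have ig := exp_bounded_integrable law_has_exp_moments gb.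
have mg := gb.1; rewrite /Rintegral fineK; last exact: integrable_fin_num.
rewrite unlock integral_distribution//; first exact/measurable_EFinP.
apply/integrableP; split.
  by apply/measurable_EFinP; exact: measurableT_comp.
have /integrableP[_] := ig; rewrite ge0_integral_distribution//.
by apply: measurableT_comp => //; exact/measurable_EFinP.
Qed.

Variables (mu s2 : R) (k : R -> R) (C e : R).
Hypothesis Mk : forall t, M t = expR (mu * t) * k t.
Hypothesis e0 : 0 < e.
Hypothesis hk : forall t, `|t| <= e -> `|k t - 1 - s2 * t ^+ 2 / 2| <= C * t ^+ 4.

Let law_total : fine (law setT) = 1.
Proof. exact: (congr1 fine (probability_setT law)). Qed.

Let center_expR t : \int[law]_y expR (t * (y - mu)) = k t.
Proof.
have -> : (fun y => expR (t * (y - mu))) = (fun y => expR (- (mu * t)) * expR (t * y)).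
  by apply/funext => y; rewrite -expRD; congr expR; ring.
rewrite RintegralZl//; last exact: law_has_exp_moments.
by rewrite Rintegral_law_expR Mk mulrA -expRD addNr expR0 mul1r.
Qed.

Let ib g : exp_bounded g -> law.-integrable setT (EFin \o g).
Proof. by apply: exp_bounded_integrable; exact: law_has_exp_moments. Qed.

Let ler_int (f g : R -> R) : exp_bounded f -> exp_bounded g -> (forall y, f y <= g y) ->
  \int[law]_y f y <= \int[law]_y g y.
Proof. by move=> fb gb fg; apply: le_Rintegral => //; exact: ib. Qed.

(** No differentiation under the integral: with [z = y - mu], the bounds on [e^(hz) - 1 - hz] and on
    [e^(hz) + e^(-hz) - 2 - h^2 z^2] are integrated and compared with the expansion of [k]. Dividing
    by [h], respectively [h^2], leaves an error linear in [h]. *)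
Lemma mgf_moments : ('E_P[X] = mu%:E)%E /\ ('V_P[X] = s2%:E)%E.
Proof.
have cb g : exp_bounded g -> exp_bounded (fun y => g (y - mu)).
  exact: exp_bounded_shift.
have zb := cb _ exp_bounded_id.
have eb t : exp_bounded (fun y => expR (t * (y - mu))).
  exact: (cb _ (exp_bounded_expR t)).
have nb := cb _ exp_bounded_norm_expR.
have int1 : \int[law]_y 1 = 1.
  by rewrite Rintegral_cst// mul1r law_total.
have C0 : 0 <= C.
  have := hk (t := e); rewrite gtr0_norm// => /(_ (lexx _)) /(le_trans (normr_ge0 _)).
  by rewrite pmulr_lge0// exprn_gt0.
have mean0 : \int[law]_y (y - mu) = 0.
  pose C1 := \int[law]_y ((y - mu) ^+ 2 * expR `|y - mu|).
  (* The cap at 1 gives [e^|hz| <= e^|z|], which makes the constant [C1] independent of [h], and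
     [h^4 <= h^2]. *)
  have e1 : 0 < Num.min e 1 by rewrite lt_min e0 ltr01.
  apply: (@eq0_of_small _ _ (C1 + `|s2| + C) _ e1) => h h0.
  rewrite le_min => /andP[he h1].
  have := hk (t := h); rewrite gtr0_norm// => /(_ he).
  have hb := exp_boundedZ h zb.
  have qb : exp_bounded (fun y => h ^+ 2 * ((y - mu) ^+ 2 * expR `|y - mu|)).
    by apply: exp_boundedZ; apply: exp_boundedM => //; exact: exp_boundedX.
  have pt y : `|expR (h * (y - mu)) - 1 - h * (y - mu)| <=
      h ^+ 2 * ((y - mu) ^+ 2 * expR `|y - mu|).
    apply: (le_trans (expR_remainder2 _)); rewrite exprMn [leRHS]mulrA.
    apply: ler_wpM2l; first by rewrite mulr_ge0 ?sqr_ge0.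
    by rewrite ler_expR normrM gtr0_norm// ler_piMl.
  have u1 : \int[law]_y expR (h * (y - mu)) <=
      \int[law]_y (1 + h * (y - mu) + h ^+ 2 * ((y - mu) ^+ 2 * expR `|y - mu|)).
    apply: ler_int => //.
      by apply: exp_boundedD => //; apply: exp_boundedD => //; exact: exp_bounded_cst.
    by move=> y; have /ler_normlP[] := pt y; lra.
  have u2 : \int[law]_y (1 + h * (y - mu)) <=
      \int[law]_y (expR (h * (y - mu)) + h ^+ 2 * ((y - mu) ^+ 2 * expR `|y - mu|)).
    apply: ler_int => //.
    - by apply: exp_boundedD => //; exact: exp_bounded_cst.
    - exact: exp_boundedD.
    by move=> y; have /ler_normlP[] := pt y; lra.
  have i1 := ib (exp_bounded_cst 1); have i2 := ib hb; have i3 := ib qb.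
  have i4 := ib (exp_boundedD (exp_bounded_cst 1) hb); have i5 := ib (eb h).
  have i6 := ib zb.
  have i7 : law.-integrable setT (EFin \o (fun y => (y - mu) ^+ 2 * expR `|y - mu|)).
    by apply: ib; apply: exp_boundedM => //; exact: exp_boundedX.
  set m := \int[law]_y (y - mu).
  have Zm : \int[law]_y (h * (y - mu)) = h * m by exact: RintegralZl.
  have Zq : \int[law]_y (h ^+ 2 * ((y - mu) ^+ 2 * expR `|y - mu|)) = h ^+ 2 * C1.
    by exact: RintegralZl.
  move: u1 u2; rewrite !RintegralD// Zm Zq int1 center_expR => u1 u2 /ler_normlP[k1 k2].
  have h2 : 0 < h ^+ 2 by rewrite exprn_gt0.
  have h4 : C * h ^+ 4 <= C * h ^+ 2.
    by apply: ler_wpM2l => //; rewrite ler_wiXn2l// ltW.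
  have s2h : `|s2 * h ^+ 2| <= `|s2| * h ^+ 2 by rewrite normrM (gtr0_norm h2).
  move/ler_normlP : s2h => [s2a s2b].
  have hh : h ^+ 2 = h * h by rewrite expr2.
  have a1 : h * m <= h * ((C1 + `|s2| + C) * h).
    have -> : h * ((C1 + `|s2| + C) * h) = h ^+ 2 * C1 + `|s2| * h ^+ 2 + C * h ^+ 2.
      by rewrite hh; ring.
    have := normr_ge0 s2; lra.
  have a2 : h * - m <= h * ((C1 + `|s2| + C) * h).
    have -> : h * ((C1 + `|s2| + C) * h) = h ^+ 2 * C1 + `|s2| * h ^+ 2 + C * h ^+ 2.
      by rewrite hh; ring.
    have := normr_ge0 s2; lra.
  by apply/ler_normlP; split; rewrite -(ler_pM2l h0).
have EX : ('E_P[X] = mu%:E)%E.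
  have gb : exp_bounded (fun y => (y - mu) + mu).
    by apply: exp_boundedD => //; exact: exp_bounded_cst.
  transitivity ('E_P[fun w => (X w - mu + mu)%R])%E.
    by congr (expectation P _); apply/funext => w; rewrite subrK.
  rewrite (expectation_law gb).
  rewrite RintegralD//; [|exact: ib|by apply: ib; exact: exp_bounded_cst].
  by rewrite mean0 add0r Rintegral_cst// law_total mulr1.
split => //.
rewrite /variance covariance.unlock EX /=.
have -> : ((X \- cst mu) * (X \- cst mu))%R = (fun w => (X w - mu) ^+ 2).
  by apply/funext => w.
rewrite (expectation_law (exp_boundedX 2 zb)).
congr EFin; apply/eqP; rewrite -subr_eq0; apply/eqP.
pose C1 := \int[law]_y ((y - mu) ^+ 4 * expR `|y - mu|).
have e1 : 0 < Num.min e 1 by rewrite lt_min e0 ltr01.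
apply: (@eq0_of_small _ _ (C1 + 2 * C) _ e1) => h h0.
rewrite le_min => /andP[he h1].
have := hk (t := h); rewrite gtr0_norm// => /(_ he).
have := hk (t := - h); rewrite normrN gtr0_norm// => /(_ he).
(* The expansion is used at both [h] and [- h], which accounts for the constant [2 * C]. *)
rewrite sqrrN (_ : (- h) ^+ 4 = h ^+ 4); last by rewrite exprNn -signr_odd mul1r.
have sb := exp_boundedX 2 zb.
have hb := exp_boundedZ (h ^+ 2) sb.
have rb : exp_bounded (fun y => (y - mu) ^+ 4 * expR `|y - mu|).
  by apply: exp_boundedM => //; exact: exp_boundedX.
have qb := exp_boundedZ (h ^+ 4) rb.
have pt y : `|expR (h * (y - mu)) + expR (- h * (y - mu)) - 2 - h ^+ 2 * (y - mu) ^+ 2| <=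
    h ^+ 4 * ((y - mu) ^+ 4 * expR `|y - mu|).
  rewrite mulNr -exprMn [leRHS]mulrA -exprMn.
  apply: (le_trans (expR_addN_remainder _)); apply: ler_wpM2l.
    by rewrite (_ : 4 = 2 * 2)%N// exprM sqr_ge0.
  by rewrite ler_expR normrM gtr0_norm// ler_piMl.
have ee := exp_boundedD (eb h) (eb (- h)).
have two := exp_bounded_cst (2 : R).
have u1 : \int[law]_y (expR (h * (y - mu)) + expR (- h * (y - mu))) <=
    \int[law]_y (2 + h ^+ 2 * (y - mu) ^+ 2 + h ^+ 4 * ((y - mu) ^+ 4 * expR `|y - mu|)).
  apply: ler_int => //.
    by apply: exp_boundedD => //; exact: exp_boundedD.
  by move=> y; have /ler_normlP[] := pt y; lra.
have u2 : \int[law]_y (2 + h ^+ 2 * (y - mu) ^+ 2) <=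
    \int[law]_y (expR (h * (y - mu)) + expR (- h * (y - mu))
      + h ^+ 4 * ((y - mu) ^+ 4 * expR `|y - mu|)).
  apply: ler_int => //; [exact: exp_boundedD|exact: exp_boundedD|].
  by move=> y; have /ler_normlP[] := pt y; lra.
have i1 := ib two; have i2 := ib hb; have i3 := ib qb.
have i4 := ib (exp_boundedD two hb); have i5 := ib (eb h); have i6 := ib (eb (- h)).
have i7 := ib ee; have i8 := ib sb; have i9 := ib rb.
have i0 := ib (exp_bounded_cst 1).
set m := \int[law]_y (y - mu) ^+ 2.
have Zm : \int[law]_y (h ^+ 2 * (y - mu) ^+ 2) = h ^+ 2 * m by exact: RintegralZl.
have Zq : \int[law]_y (h ^+ 4 * ((y - mu) ^+ 4 * expR `|y - mu|)) = h ^+ 4 * C1.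
  by exact: RintegralZl.
move: u1 u2; rewrite !RintegralD// Zm Zq int1 !center_expR => u1 u2 /ler_normlP[k1 k2] /ler_normlP[k3 k4].
have h2 : 0 < h ^+ 2 by rewrite exprn_gt0.
have C10 : 0 <= C1.
  apply: Rintegral_ge0 => y _; rewrite mulr_ge0 ?expR_ge0//.
  by rewrite (_ : 4 = 2 * 2)%N// exprM sqr_ge0.
have h4E : h ^+ 4 = h ^+ 2 * h ^+ 2 by rewrite -exprD.
have hh : h ^+ 2 <= h by rewrite expr2 ler_piMl// ltW.
have a0 : h ^+ 2 * (C1 + 2 * C) <= (C1 + 2 * C) * h.
  by rewrite mulrC ler_wpM2l// addr_ge0// mulr_ge0.
have a1 : h ^+ 2 * (m - s2) <= h ^+ 2 * (h ^+ 2 * (C1 + 2 * C)).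
  by move: u1 u2 k1 k2 k3 k4; rewrite h4E; move: (h ^+ 2) => H; lra.
have a2 : h ^+ 2 * - (m - s2) <= h ^+ 2 * (h ^+ 2 * (C1 + 2 * C)).
  by move: u1 u2 k1 k2 k3 k4; rewrite h4E; move: (h ^+ 2) => H; lra.
move: a1 a2; rewrite !(ler_pM2l h2) => a1 a2.
by apply/ler_normlP; split; [exact: le_trans a2 a0|exact: le_trans a1 a0].
Qed.

End mgf.

(** * The moment generating function of the standard normal law *)

Section normal.
Context {R : realType}.
Local Notation leb := (@lebesgue_measure R).
Local Notation gauss := (normal_prob (0 : R) 1).

(** The Radon-Nikodym derivative and the Gaussian density have equal integrals over measurable sets,
    hence agree almost everywhere. *)
Lemma ge0_integral_normal_prob (g : R -> R) :
    measurable_fun setT g -> (forall y, 0 <= g y) ->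
  (\int[gauss]_y (g y)%:E = \int[leb]_y (g y * normal_pdf 0 1 y)%:E)%E.
Proof.
move=> mg g0; have dom := normal_prob_dominates (0 : R) 1.
rewrite -(Radon_Nikodym_SigmaFinite.change_of_variables dom)//=; last first.
  exact/measurable_EFinP.
apply: ae_eq_integral => //=.
- apply: emeasurable_funM; first exact/measurable_EFinP.
  by apply: (measurable_int leb); exact: Radon_Nikodym_SigmaFinite.f_integrable.
- apply/measurable_EFinP; apply: measurable_funM => //.
  exact: measurable_normal_pdf.
have : ae_eq leb setT (Radon_Nikodym_SigmaFinite.f gauss leb)
    (fun y => (normal_pdf 0 1 y)%:E).
  apply: integral_ae_eq => //.
  - exact: Radon_Nikodym_SigmaFinite.f_integrable.
  - by apply/measurable_EFinP; exact: measurable_normal_pdf.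
  - by move=> E _ mE; rewrite -Radon_Nikodym_SigmaFinite.f_integral.
by apply: filterS => y /= h _; rewrite h// EFinM.
Qed.

Lemma normal_mgf (s : R) :
  (\int[gauss]_y (expR (s * y))%:E = (expR (s ^+ 2 / 2))%:E)%E.
Proof.
rewrite ge0_integral_normal_prob//; first last.
- exact: measurable_expRM.
(* Completing the square: the tilt by [s] is a translation by [s]. *)
have E y : expR (s * y) * normal_pdf 0 1 y = expR (s ^+ 2 / 2) * normal_pdf s 1 y.
  rewrite !normal_pdfE ?oner_neq0// mulrCA [RHS]mulrCA; congr (_ * _).
  by rewrite /normal_fun -!expRD; congr expR; field.
under eq_integral do rewrite E EFinM.
rewrite ge0_integralZl//=.
- by rewrite integral_normal_pdf mule1.
- by apply/measurable_EFinP; exact: measurable_normal_pdf.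
- by move=> y _; rewrite lee_fin normal_pdf_ge0.
Qed.

Lemma normal_has_exp_moments : has_exp_moments gauss.
Proof.
move=> s; apply/integrableP; split.
  by apply/measurable_EFinP; exact: measurable_expRM.
under eq_integral do rewrite /= ger0_norm ?expR_ge0//.
by rewrite normal_mgf ltry.
Qed.

Lemma cvg_mgf_normal (d : nat -> measure_display) (T : forall N, measurableType (d N))
    (P : forall N, probability (T N) R) (Y : forall N, T N -> R) (M : nat -> R -> R) :
    (forall N, measurable_fun setT (Y N)) ->
    (forall N t, ('E_(P N)[fun w => expR (t * Y N w)%R] = (M N t)%:E)%E) ->
    (forall t, M N t @[N --> \oo] --> expR (t ^+ 2 / 2)) ->
  cvg_in_distribution P Y gauss.
Proof.
move=> mY hM cM x cx.
apply: (@mgf_cvg_cdf _ (fun N => law (P N) (mY N)) gauss) => //.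
- by move=> N; exact: law_has_exp_moments (hM N).
- exact: normal_has_exp_moments.
- move=> s; rewrite {2}/Rintegral normal_mgf /=.
  under eq_fun => N do rewrite (Rintegral_law_expR (mY N) (hM N)).
  exact: cM.
Qed.

End normal.

(** * Centred uniform laws on [{0, ..., n-1}] *)

Section qint_exp.
Context {R : realType}.
Implicit Types (t x : R) (n : nat).

Lemma poly_evalM (f g : {poly int}) (q : R) :
  poly_eval (f * g) q = poly_eval f q * poly_eval g q.
Proof. by rewrite /poly_eval rmorphM hornerM. Qed.

Lemma poly_eval_prod (s : seq nat) (q : R) :
  poly_eval (\prod_(x <- s) qint x) q = \prod_(x <- s) poly_eval (qint x) q.
Proof. by rewrite /poly_eval rmorph_prod horner_prod. Qed.

Lemma poly_eval_qint n (q : R) : poly_eval (qint n) q = \sum_(i < n) q ^+ i.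
Proof.
rewrite /poly_eval /qint rmorph_sum horner_sum; apply: eq_bigr => i _.
by rewrite rmorphXn /= map_polyX hornerXn.
Qed.

Definition qint_center n (i : nat) : R := i%:R - (n%:R - 1) / 2.

(** For [0 < n], the moment generating function of the uniform law on [{0, ..., n-1}] shifted to
    mean 0. *)
Definition qint_mgf n t : R := n%:R^-1 * \sum_(i < n) expR (t * qint_center n i).

Lemma poly_eval_qint_expR n t : (0 < n)%N ->
  poly_eval (qint n) (expR t) = n%:R * expR (t * ((n%:R - 1) / 2)) * qint_mgf n t.
Proof.
move=> n0; rewrite poly_eval_qint /qint_mgf mulrACA divff ?pnatr_eq0 -?lt0n//.
rewrite mul1r mulr_sumr; apply: eq_bigr => i _.
by rewrite -expRM_natr -expRD /qint_center; congr expR; ring.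
Qed.

Lemma qint_mgfN n t : qint_mgf n (- t) = qint_mgf n t.
Proof.
case: n => [|n]; first by rewrite /qint_mgf !big_ord0.
rewrite /qint_mgf (reindex_inj rev_ord_inj) /=; congr (_ * _).
apply: eq_bigr => i _; congr expR; rewrite /qint_center subSS natrB -1?ltnS//.
by rewrite -natr1; field.
Qed.

Lemma sum_sqr_qint_center n :
  \sum_(i < n) qint_center n i ^+ 2 = n%:R * (n%:R ^+ 2 - 1) / 12.
Proof.
(* The centre depends on [n], so the induction is run for a fixed centre [c]. *)
have S (c : R) m : \sum_(i < m) (i%:R - c) ^+ 2 =
    m%:R * (m%:R - 1) * (2 * m%:R - 1) / 6 - c * m%:R * (m%:R - 1) + m%:R * c ^+ 2.
  elim: m => [|m ih]; first by rewrite big_ord0; field.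
  by rewrite big_ord_recr /= ih -natr1; field.
by rewrite /qint_center S; field.
Qed.

Lemma qint_center_le n (i : 'I_n) : `|qint_center n i| <= n%:R.
Proof.
have : (i%:R : R) + 1 <= n%:R by rewrite natr1 ler_nat ltn_ord.
have : 0 <= (i%:R : R) by [].
by rewrite /qint_center => h1 h2; apply/ler_normlP; split; lra.
Qed.

(** By symmetry the sum is half of the sum over [t] and [- t], which removes the odd orders. The
    constant 2 is half of the bound 4 for [e]. *)
Lemma qint_mgf_approx n t : (0 < n)%N -> `|t| * n%:R <= 1 ->
  `|qint_mgf n t - 1 - t ^+ 2 * (n%:R ^+ 2 - 1) / 24| <= 2 * (t * n%:R) ^+ 4.
Proof.
move=> n0 tn.
have nR : (0 : R) < n%:R by rewrite ltr0n.
have -> : qint_mgf n t - 1 - t ^+ 2 * (n%:R ^+ 2 - 1) / 24 =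
    (2 * n%:R)^-1 * \sum_(i < n) (expR (t * qint_center n i) +
      expR (- (t * qint_center n i)) - 2 - (t * qint_center n i) ^+ 2).
  rewrite !sumrB big_split /=.
  under [\sum_(i < n) (_ ^+ 2)]eq_bigr do rewrite exprMn.
  rewrite -mulr_sumr sum_sqr_qint_center.
  have E1 : \sum_(i < n) expR (t * qint_center n i) = n%:R * qint_mgf n t.
    by rewrite /qint_mgf mulrA divff ?mul1r// gt_eqF.
  have E2 : \sum_(i < n) expR (- (t * qint_center n i)) = n%:R * qint_mgf n t.
    rewrite -qint_mgfN /qint_mgf mulrA divff ?mul1r ?gt_eqF//.
    by apply: eq_bigr => i _; rewrite mulNr.
  rewrite E1 E2 sumr_const card_ord -[2 *+ n]mulr_natr.
  by field; rewrite gt_eqF.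
rewrite normrM ger0_norm ?invr_ge0 ?mulr_ge0 ?(ltW nR)//.
rewrite mulrC ler_pdivrMr ?mulr_gt0//.
apply: (le_trans (ler_norm_sum _ _ _)).
have b (i : 'I_n) : `|t * qint_center n i| <= `|t| * n%:R.
  by rewrite normrM ler_wpM2l// qint_center_le.
have e4 : expR (1 : R) <= 4.
  have := expR_ge1Dx (- 2^-1 : R); rewrite expRN => h.
  have e0 : 0 < expR (2^-1 : R) by rewrite expR_gt0.
  have e2 : expR (2^-1 : R) <= 2.
    by rewrite -[leRHS]invrK -[leLHS]invrK lef_pV2 ?posrE ?invr_gt0//; lra.
  have -> : (1 : R) = 2^-1 + 2^-1 by field.
  by rewrite expRD; nra.
apply: (@le_trans _ _ (\sum_(i < n) (t * n%:R) ^+ 4 * 4)); last first.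
  rewrite sumr_const card_ord -[leLHS]mulr_natr.
  by rewrite le_eqVlt; apply/orP; left; apply/eqP; ring.
apply: ler_sum => i _; apply: (le_trans (expR_addN_remainder _)).
have X4 (x : R) : x ^+ 4 = `|x| ^+ 4.
  by rewrite -normrX ger0_norm// (_ : 4 = 2 * 2)%N// exprM sqr_ge0.
apply: ler_pM; rewrite ?expR_ge0//.
- by rewrite (_ : 4 = 2 * 2)%N// exprM sqr_ge0.
- rewrite X4 [leRHS]X4 [in leRHS]normrM (ger0_norm (ltW nR)).
  by apply: lerXn2r; rewrite ?nnegrE ?mulr_ge0// ltW.
- by rewrite (le_trans _ e4)// ler_expR (le_trans (b i)).
Qed.

Lemma qint_mgf_gt0 n t : (0 < n)%N -> 0 < qint_mgf n t.
Proof.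
case: n => // n _; rewrite /qint_mgf mulr_gt0 ?invr_gt0 ?ltr0n//.
by rewrite big_ord_recl ltr_wpDr ?expR_gt0 ?sumr_ge0// => i _; rewrite expR_ge0.
Qed.

(** Both sides follow from [ln (1 + x) <= x], taken at [u] and at [- u / (1 + u)]. *)
Lemma ln_approx (u : R) : -1 / 2 <= u -> `|ln (1 + u) - u| <= 2 * u ^+ 2.
Proof.
move=> u2; have u1 : 0 < 1 + u by lra.
have lu : ln (1 + u) <= u by apply: le_ln1Dx; lra.
have : ln (1 - u / (1 + u)) <= - (u / (1 + u)).
  apply: le_ln1Dx; rewrite ltrN2 ltr_pdivrMr//; lra.
have -> : 1 - u / (1 + u) = (1 + u)^-1 by field; rewrite gt_eqF.
rewrite lnV ?posrE// lerN2 => ul.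
have : u - 2 * u ^+ 2 <= u / (1 + u).
  rewrite ler_pdivlMr//; have := sqr_ge0 u; nra.
by move=> h; apply/ler_normlP; split; have := sqr_ge0 u; lra.
Qed.

Lemma ln_qint_mgf n t : (0 < n)%N -> `|t| * n%:R <= 2^-1 ->
  `|ln (qint_mgf n t) - t ^+ 2 * (n%:R ^+ 2 - 1) / 24| <= 4 * (t * n%:R) ^+ 4.
Proof.
move=> n0 tn.
have nR : (1 : R) <= n%:R by rewrite ler1n.
have := @qint_mgf_approx n t n0 ltac:(lra).
set u := qint_mgf n t - 1; set v := t ^+ 2 * _ / 24.
set w := (t * n%:R) ^+ 2.
have -> : (t * n%:R) ^+ 4 = w ^+ 2 by rewrite /w -exprM.
have w0 : 0 <= w by exact: sqr_ge0.
have w1 : w <= 4^-1.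
  have -> : w = (`|t| * n%:R) ^+ 2 by rewrite /w !exprMn real_normK ?num_real.
  have : 0 <= `|t| * n%:R by rewrite mulr_ge0//; lra.
  by move: (`|t| * n%:R) tn => z z2 z0; rewrite expr2; nra.
have v0 : 0 <= v.
  by rewrite /v mulr_ge0// mulr_ge0 ?sqr_ge0//; nra.
have vw : v <= w / 24.
  by rewrite /v /w exprMn ler_wpM2r// ler_wpM2l ?sqr_ge0//; lra.
move=> /ler_normlP[a1 a2].
have hu : -1 / 2 <= u by nra.
have := ln_approx hu; have -> : 1 + u = qint_mgf n t by rewrite /u addrC subrK.
move=> /ler_normlP[b1 b2].
(* The total error is [2 * w ^+ 2] from the expansion plus [2 * u ^+ 2] from the logarithm. *)
have u2 : u ^+ 2 <= w ^+ 2.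
  have : - w <= u <= w by apply/andP; split; nra.
  by move=> /andP[]; nra.
by apply/ler_normlP; split; lra.
Qed.

End qint_exp.

(** * Roots of unity and the size of the denominator entries *)

Lemma qint_root (n : nat) (z : algC) : n.-primitive_root z -> (1 < n)%N ->
  forall m, ((map_poly intr (qint m)).[z] == 0 :> algC) = (n %| m)%N.
Proof.
move=> zn n1 m.
have z1 : z - 1 != 0.
  rewrite subr_eq0 -[z]expr1 -(prim_order_dvd zn).
  by apply/negP => /dvdn_leq; lia.
have -> : (map_poly intr (qint m)).[z] = \sum_(i < m) z ^+ i.
  rewrite /qint rmorph_sum horner_sum; apply: eq_bigr => i _.
  by rewrite rmorphXn /= map_polyX hornerXn.
rewrite -(inj_eq (mulfI z1)) mulr0 -subrX1 subr_eq0.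
by rewrite -(prim_order_dvd zn).
Qed.

(* A factor [qint y] of the denominator vanishes at a primitive [y]-th root of
   unity, so it can only be cancelled by some [qint x] with [y %| x]. *)
Lemma denominator_le (A B : seq nat) (f : {poly int}) :
  f * (\prod_(x <- B) qint x) = \prod_(x <- A) qint x ->
  all (fun x => 0 < x)%N A ->
  forall y, y \in B -> (1 < y)%N -> exists2 x, x \in A & (y <= x)%N.
Proof.
move=> fAB A0 y yB y1.
have [z zy] := C_prim_root_exists (ltnW y1).
have zy0 : (map_poly intr (qint y)).[z] = 0 :> algC.
  by apply/eqP; rewrite (qint_root zy y1) dvdnn.
have : (map_poly intr (\prod_(x <- A) qint x)).[z] = 0 :> algC.
  rewrite -fAB rmorphM hornerM (big_rem y)//= rmorphM hornerM.
  by rewrite zy0 mul0r mulr0.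
rewrite rmorph_prod horner_prod => /eqP; rewrite prodf_seq_eq0.
move=> /hasP[x xA /=]; rewrite (qint_root zy y1) => yx.
by exists x => //; apply: dvdn_leq => //; exact: (allP A0).
Qed.

(** * Transform, mean and variance for one cyclotomic generating function *)

Section single.
Context {R : realType}.
Variables (A B : seq nat) (f : {poly int}).
Hypothesis A0 : all (fun x => 0 < x)%N A.
Hypothesis B0 : all (fun x => 0 < x)%N B.
Hypothesis fAB : f * (\prod_(x <- B) qint x) = \prod_(x <- A) qint x.

Definition cgf_mean : R :=
  \sum_(x <- A) (x%:R - 1) / 2 - \sum_(x <- B) (x%:R - 1) / 2.
Definition cgf_var : R :=
  (\sum_(x <- A) (x%:R ^+ 2 - 1) - \sum_(x <- B) (x%:R ^+ 2 - 1)) / 12.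
(** The candidate for the moment generating function of the centred variable, the linear exponents
    being collected in [cgf_mean]. *)
Definition cgf_kernel (t : R) :=
  (\prod_(x <- A) qint_mgf x t) / (\prod_(x <- B) qint_mgf x t).

Lemma prod_qint_mgf_gt0 (s : seq nat) (t : R) : all (fun x => 0 < x)%N s ->
  0 < \prod_(x <- s) qint_mgf x t.
Proof.
move=> /allP s0; rewrite big_seq; apply: prodr_gt0 => x xs.
by rewrite qint_mgf_gt0// s0.
Qed.

Lemma cgf_kernel_gt0 t : 0 < cgf_kernel t.
Proof. by rewrite /cgf_kernel divr_gt0// prod_qint_mgf_gt0. Qed.

Lemma poly_eval_prod_expR (s : seq nat) (t : R) : all (fun x => 0 < x)%N s ->
  poly_eval (\prod_(x <- s) qint x) (expR t) =
  (\prod_(x <- s) x%:R) * expR (t * \sum_(x <- s) (x%:R - 1) / 2)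
  * \prod_(x <- s) qint_mgf x t.
Proof.
rewrite poly_eval_prod; elim: s => [|x s ih] /=.
  by rewrite !big_nil mulr0 expR0 !mulr1.
move=> /andP[x0 s0]; rewrite !big_cons ih// poly_eval_qint_expR//.
by rewrite mulrDr expRD; ring.
Qed.

Lemma qint_mgf0 n : (0 < n)%N -> qint_mgf n 0 = 1 :> R.
Proof.
move=> n0; rewrite /qint_mgf; under eq_bigr do rewrite mul0r expR0.
by rewrite sumr_const card_ord mulVf// pnatr_eq0 -lt0n.
Qed.

Lemma prod_qint_mgf0 (s : seq nat) : all (fun x => 0 < x)%N s ->
  \prod_(x <- s) qint_mgf x 0 = 1 :> R.
Proof.
by move=> /allP s0; rewrite big_seq big1// => x xs; rewrite qint_mgf0// s0.
Qed.

Lemma cgf_mgf t :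
  poly_eval f (expR t) / poly_eval f 1 = expR (cgf_mean * t) * cgf_kernel t.
Proof.
pose pr (s : seq nat) : R := \prod_(x <- s) x%:R.
have pr0 s : all (fun x => 0 < x)%N s -> pr s != 0.
  move=> /allP s0; rewrite gt_eqF// /pr big_seq prodr_gt0// => x xs.
  by rewrite ltr0n s0.
have E u : poly_eval f (expR u) = pr A / pr B * (expR (cgf_mean * u) * cgf_kernel u).
  have := congr1 (fun p => poly_eval p (expR u)) fAB.
  rewrite poly_evalM !poly_eval_prod_expR// -/(pr A) -/(pr B) => H.
  have kB := prod_qint_mgf_gt0 u B0.
  apply: (@mulIf _ (pr B * expR (u * \sum_(x <- B) (x%:R - 1) / 2)
    * \prod_(x <- B) qint_mgf x u)).
    by rewrite !mulf_neq0 ?pr0// gt_eqF// expR_gt0.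
  rewrite H /cgf_kernel /cgf_mean mulrBl expRD [in RHS](mulrC _ u) [in RHS](mulrC _ u) expRN.
  by field; rewrite !pr0//= !gt_eqF ?expR_gt0.
(* At 0 the kernel is 1, which identifies [poly_eval f 1] with [pr A / pr B]. *)
rewrite E; have := E 0; rewrite expR0 mulr0 expR0 mul1r.
rewrite /cgf_kernel !prod_qint_mgf0// divr1 mulr1 => ->.
by field; rewrite !pr0// gt_eqF ?prod_qint_mgf_gt0.
Qed.

(** The errors of the factors add up, each [x^4] being bounded by [M^2 x^2]. *)
Lemma ln_prod_approx (s : seq nat) (M : nat) (t : R) :
    all (fun x => 0 < x)%N s -> all (fun x => x <= M)%N s -> `|t| * M%:R <= 2^-1 ->
  `|ln (\prod_(x <- s) qint_mgf x t) -
    t ^+ 2 * (\sum_(x <- s) (x%:R ^+ 2 - 1)) / 24| <=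
  4 * t ^+ 4 * M%:R ^+ 2 * \sum_(x <- s) x%:R ^+ 2.
Proof.
move=> + + tM; elim: s => [|x s ih] /=.
  by rewrite !big_nil ln1 !mulr0 mul0r subrr normr0.
move=> /andP[x0 s0] /andP[xM sM]; rewrite !big_cons.
rewrite lnM ?posrE ?qint_mgf_gt0 ?prod_qint_mgf_gt0//.
have xM' : (x%:R : R) <= M%:R by rewrite ler_nat.
have tx : `|t| * x%:R <= 2^-1 by rewrite (le_trans _ tM)// ler_wpM2l.
have h : 4 * (t * x%:R) ^+ 4 <= 4 * t ^+ 4 * M%:R ^+ 2 * (x%:R : R) ^+ 2.
  have -> : 4 * (t * x%:R) ^+ 4 = 4 * t ^+ 4 * x%:R ^+ 2 * x%:R ^+ 2 by ring.
  apply: ler_wpM2r; first exact: sqr_ge0.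
  apply: ler_wpM2l; last by apply: lerXn2r; rewrite ?nnegrE.
  by rewrite mulr_ge0// (_ : 4 = 2 * 2)%N// exprM sqr_ge0.
have := ih s0 sM; have := ln_qint_mgf x0 tx.
set S1 := \sum_(_ <- _) _; set S2 := \sum_(_ <- _) _.
move=> /ler_normlP[a1 a2] /ler_normlP[b1 b2].
by apply/ler_normlP; split; rewrite [leRHS]mulrDr; lra.
Qed.

Lemma ln_cgf_kernel (M : nat) (t : R) :
    all (fun x => x <= M)%N A -> all (fun x => x <= M)%N B -> `|t| * M%:R <= 2^-1 ->
  `|ln (cgf_kernel t) - cgf_var * t ^+ 2 / 2| <=
  4 * t ^+ 4 * M%:R ^+ 2 * (\sum_(x <- A) x%:R ^+ 2 + \sum_(x <- B) x%:R ^+ 2).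
Proof.
move=> AM BM tM; rewrite /cgf_kernel ln_div ?posrE ?prod_qint_mgf_gt0//.
have := ln_prod_approx A0 AM tM; have := ln_prod_approx B0 BM tM.
rewrite /cgf_var; move=> /ler_normlP[a1 a2] /ler_normlP[b1 b2].
by apply/ler_normlP; split; rewrite [leRHS]mulrDr; lra.
Qed.

(** Supplies the expansion from which mean and variance are read off: the logarithm [z] of the
    kernel is [O(t^2)], so [e^z - 1 - z] is [O(t^4)]. The constants may depend on [A] and [B]. *)
Lemma cgf_kernel_approx : exists C e : R, 0 < e /\
  forall t, `|t| <= e -> `|cgf_kernel t - 1 - cgf_var * t ^+ 2 / 2| <= C * t ^+ 4.
Proof.
pose M := (\max_(x <- A ++ B) x)%N.
have leM s : {subset s <= A ++ B} -> all (fun x => x <= M)%N s.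
  by move=> sAB; apply/allP => x xs; rewrite /M leq_bigmax_seq// sAB.
have AM : all (fun x => x <= M)%N A by apply: leM => x xA; rewrite mem_cat xA.
have BM : all (fun x => x <= M)%N B by apply: leM => x xB; rewrite mem_cat xB orbT.
pose D : R := 4 * M%:R ^+ 2 * (\sum_(x <- A) x%:R ^+ 2 + \sum_(x <- B) x%:R ^+ 2).
have D0 : 0 <= D.
  rewrite /D mulr_ge0 ?mulr_ge0 ?sqr_ge0// addr_ge0// sumr_ge0// => x _;
  exact: sqr_ge0.
pose E := `|cgf_var| + D.
have E0 : 0 <= E by rewrite addr_ge0.
(* This radius ensures both [|t| * M <= 1/2] and [|t| <= 1]. *)
pose e : R := (2 * (M%:R + 1))^-1.
have M0 : (0 : R) <= M%:R by [].
have e0 : 0 < e by rewrite invr_gt0; lra.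
have eM : e * (M%:R + 1) = 2^-1 by rewrite /e; field; lra.
have e1 : e <= 1 by nra.
exists (D + E ^+ 2 * expR E), e; split => // t te.
have tM : `|t| * M%:R <= 2^-1.
  by rewrite (@le_trans _ _ (e * M%:R)) ?ler_wpM2r//; lra.
have := ln_cgf_kernel AM BM tM.
have -> : 4 * t ^+ 4 * M%:R ^+ 2 * (\sum_(x <- A) x%:R ^+ 2 + \sum_(x <- B) x%:R ^+ 2)
  = D * t ^+ 4 by rewrite /D; ring.
have t4E : t ^+ 4 = t ^+ 2 * t ^+ 2 by rewrite -exprD.
have t20 : 0 <= t ^+ 2 by exact: sqr_ge0.
have t21 : t ^+ 2 <= 1.
  by rewrite -[t ^+ 2]real_normK ?num_real// exprn_ile1// (le_trans te).
set z := ln _ => hz.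
have kE : cgf_kernel t = expR z by rewrite /z lnK// posrE cgf_kernel_gt0.
have zE : `|z| <= E * t ^+ 2.
  have -> : z = (z - cgf_var * t ^+ 2 / 2) + cgf_var * t ^+ 2 / 2 by rewrite subrK.
  rewrite (le_trans (ler_normD _ _))// /E mulrDl addrC lerD//.
    have t22 : 0 <= t ^+ 2 / 2 by lra.
    by rewrite -mulrA normrM (ger0_norm t22) ler_wpM2l//; lra.
  by rewrite (le_trans hz)// t4E ler_wpM2l// ler_piMr.
have z2 : z ^+ 2 <= E ^+ 2 * t ^+ 4.
  rewrite t4E -[z ^+ 2]real_normK ?num_real// -expr2 -exprMn.
  by rewrite lerXn2r// nnegrE mulr_ge0.
have := expR_remainder2 z.
have zE' : z ^+ 2 * expR `|z| <= E ^+ 2 * expR E * t ^+ 4.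
  rewrite [leRHS]mulrAC; apply: ler_pM; rewrite ?sqr_ge0 ?expR_ge0// ler_expR.
  by rewrite (le_trans zE)// ler_piMr.
rewrite kE; move: hz => /ler_normlP[a1 a2] /ler_normlP[b1 b2].
by apply/ler_normlP; split; lra.
Qed.

Section moments.
Context d (T : measurableType d) (P : probability T R) (X : {RV P >-> R}).
Hypothesis hX : has_gen_fun X f.

Lemma cgf_expectation_expR t :
  ('E_P[fun w => expR (t * X w)%R] = (expR (cgf_mean * t) * cgf_kernel t)%:E)%E.
Proof.
rewrite -cgf_mgf -hX ?expR_gt0//; congr (expectation P _).
by apply/funext => w; rewrite expRM.
Qed.

Lemma cgf_moments : ('E_P[X] = cgf_mean%:E)%E /\ ('V_P[X] = cgf_var%:E)%E.
Proof.
have [C [e [e0 H]]] := cgf_kernel_approx.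
have mX : measurable_fun setT X by [].
exact: (mgf_moments mX cgf_expectation_expR (fun=> erefl) e0 H).
Qed.

Lemma cgf_standardize_mgf s :
  ('E_P[fun w => expR (s * standardize X w)%R] =
    (cgf_kernel (s / Num.sqrt cgf_var))%:E)%E.
Proof.
have [EX VX] := cgf_moments; pose t := s / Num.sqrt cgf_var.
have -> : (fun w => expR (s * standardize X w)) =
    (fun w => expR (- (cgf_mean * t)) * expR (t * X w)).
  apply/funext => w; rewrite /standardize EX VX /= -expRD; congr expR.
  by rewrite /t; ring.
have := cgf_expectation_expR t; rewrite unlock => H.
under eq_integral do rewrite EFinM.
rewrite ge0_integralZl//=.
- by rewrite H -EFinM mulrA -expRD addNr expR0 mul1r.
- by apply/measurable_EFinP; apply: measurableT_comp => //; apply: measurable_funM.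
Qed.

End moments.
End single.

(** * Sums over multisets of positive integers *)

Section asymptotics.
Context {R : realType}.

Lemma sum_sqr_size (s : seq nat) :
  \sum_(x <- s) (x%:R : R) ^+ 2 = \sum_(x <- s) (x%:R ^+ 2 - 1) + (size s)%:R.
Proof. by rewrite sumrB -sum1_size natr_sum subrK. Qed.

Lemma sum_sqrB1_ge0 (s : seq nat) : all (fun x => 0 < x)%N s ->
  0 <= \sum_(x <- s) ((x%:R : R) ^+ 2 - 1).
Proof.
move=> /allP s0; rewrite big_seq sumr_ge0// => x /s0 x0.
have : (1 : R) <= x%:R by rewrite ler1n.
by rewrite expr2; nra.
Qed.

Lemma size_le_sum_sqrB1 (s : seq nat) : all (fun x => 0 < x)%N s -> 1%N \notin s ->
  (size s)%:R * 3 <= \sum_(x <- s) ((x%:R : R) ^+ 2 - 1).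
Proof.
move=> /allP s0 s1; rewrite -sum1_size natr_sum mulr_suml !big_seq.
apply: ler_sum => x xs.
have : (2 : R) <= x%:R.
  rewrite (ler_nat R 2); have := s0 _ xs.
  by have : x != 1%N by [apply: contraNneq s1 => <-|]; lia.
by rewrite expr2; nra.
Qed.

Lemma sum_quartic_le (s : seq nat) (M : nat) : all (fun x => x <= M)%N s ->
  \sum_(x <- s) (x%:R / M%:R : R) ^+ 4 <= (\sum_(x <- s) (x%:R : R) ^+ 2) / M%:R ^+ 2.
Proof.
move=> /allP sM; rewrite mulr_suml !big_seq; apply: ler_sum => x /sM xM.
(* For [M = 0] both sides vanish, the inverse of 0 being 0. *)
have [M0|M0] := posnP M.
  by rewrite M0 mulr0n [in leRHS]expr0n /= invr0 !mulr0 expr0n.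
have MR : (0 : R) < M%:R by rewrite ltr0n.
rewrite -expr_div_n (_ : 4 = 2 * 2)%N// exprM.
have h0 : 0 <= (x%:R / M%:R : R) by rewrite divr_ge0.
have h1 : (x%:R / M%:R : R) <= 1 by rewrite ler_pdivrMr// mul1r ler_nat.
have u0 := exprn_ge0 2 h0; have u1 := exprn_ile1 2 h0 h1.
by move: (_ ^+ 2) u0 u1 => u u0 u1; rewrite expr2; nra.
Qed.

(** * Quantitative normal approximation for one generating function *)

Section single.
Variables (A B : seq nat) (f : {poly int}) (r : R).
Hypothesis A0 : all (fun x => 0 < x)%N A.
Hypothesis B0 : all (fun x => 0 < x)%N B.
Hypothesis fAB : f * (\prod_(x <- B) qint x) = \prod_(x <- A) qint x.
Hypothesis sAB : size A = size B.
Hypothesis h1 : ~ (1%N \in A /\ 1%N \in B).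
Let QA : R := \sum_(x <- A) (x%:R ^+ 2 - 1).
Let QB : R := \sum_(x <- B) (x%:R ^+ 2 - 1).
Let M : nat := (\max_(x <- A) x)%N.
Let H : R := \sum_(x <- A) (x%:R / M%:R) ^+ 4.
Hypothesis r1 : r < 1.
Hypothesis QBA : QB / QA <= r.
Hypothesis H0 : 0 < H.

Let AM : all (fun x => x <= M)%N A.
Proof. by apply/allP => x xA; rewrite /M leq_bigmax_seq. Qed.

Let A_nonempty : (0 < size A)%N.
Proof. by move: H0; rewrite /H; case: (A) => //; rewrite big_nil ltxx. Qed.

Let M_gt0 : (0 < M)%N.
Proof.
move: A_nonempty A0 AM; case: (A) => //= x s _ /andP[x0 _] /andP[+ _].
exact: leq_trans.
Qed.

Lemma denominator_le_max : all (fun x => x <= M)%N B.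
Proof.
apply/allP => y yB; have [y1|y1] := leqP y 1; first exact: leq_trans M_gt0.
have [x xA yx] := denominator_le fAB A0 yB y1.
by rewrite (leq_trans yx)// (allP AM).
Qed.

(** If [QA] vanished, all entries of [A], and with them the smaller entries of [B], would be 1,
    against [h1]. Since division by 0 yields 0, [QBA] with [0 <= r] does not exclude this case. *)
Lemma sum_sqrB1_gt0 : 0 < QA.
Proof.
rewrite lt_neqAle sum_sqrB1_ge0// andbT eq_sym; apply/negP => QA0.
have A1 (x : nat) : x \in A -> x = 1%N.
  move=> xA; have := QA0; rewrite /QA big_seq psumr_eq0.
    move=> /allP/(_ _ xA); rewrite xA /= => /eqP x2.
    have := allP A0 _ xA; have [x1|x1] := leqP x 1; first by move: x1; clear; lia.
    have : (2 : R) <= x%:R by rewrite (ler_nat R 2).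
    by move=> x3; exfalso; move: x2; rewrite expr2; nra.
  move=> z /(allP A0)/= z0; have : (1 : R) <= z%:R by rewrite ler1n.
  by rewrite expr2; nra.
have BleM : {subset B <= [:: 1%N]}.
  move=> y yB; rewrite inE.
  have := allP denominator_le_max _ yB; have := allP B0 _ yB.
  have : (M <= 1)%N.
    by rewrite /M; apply/bigmax_leqP_seq => x xA _; rewrite (A1 _ xA).
  by clear; lia.
apply: h1; split.
  by move: A_nonempty A1; case: (A) => // x s _ /(_ x); rewrite inE eqxx => -> //;
    rewrite inE.
move: A_nonempty BleM; rewrite sAB; case: (B) => // y s _ /(_ y).
by rewrite inE eqxx inE => /(_ isT)/eqP ->; rewrite inE.
Qed.

Let QBr : QB <= r * QA.
Proof. by rewrite -ler_pdivrMr// sum_sqrB1_gt0. Qed.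

(** By [h1] one of [A] and [B] has no entry 1, and each of its entries contributes at least 3. If it
    is [B], equal sizes and [QB <= QA] carry the bound over. *)
Lemma size_le_third : (size A)%:R * 3 <= QA.
Proof.
have QA0 := sum_sqrB1_gt0.
have [A1|A1] := boolP (1%N \in A); last exact: size_le_sum_sqrB1.
have B1 : 1%N \notin B by apply/negP => B1; apply: h1.
rewrite sAB (le_trans (size_le_sum_sqrB1 B0 B1))// -/QB (le_trans QBr)//.
exact: (ler_piMl (ltW QA0) (ltW r1)).
Qed.

Lemma cgf_var_ge : (1 - r) * QA <= 12 * cgf_var A B :> R.
Proof. by rewrite /cgf_var -/QA -/QB; have := QBr; lra. Qed.

(** Together with [cgf_var_ge] this makes [M^2] small against the variance when [H] is large. *)
Lemma max_sqr_le : H * M%:R ^+ 2 <= 4 / 3 * QA.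
Proof.
have MR : (0 : R) < M%:R ^+ 2 by rewrite exprn_gt0// ltr0n.
rewrite -ler_pdivlMr//; apply: (le_trans (sum_quartic_le AM)).
rewrite ler_pM2r ?invr_gt0// sum_sqr_size -/QA.
by have := size_le_third; lra.
Qed.

Lemma cgf_var_gt0 : 0 < cgf_var A B :> R.
Proof.
have := cgf_var_ge; have : 0 < (1 - r) * QA by rewrite mulr_gt0 ?sum_sqrB1_gt0// subr_gt0.
by lra.
Qed.

(** The condition on [s] gives [|t| * M <= 1/2], so [ln_cgf_kernel] applies; its error is regrouped
    as [t^2 M^2], of order [s^2 / H], times [t^2 QA], of order [s^2]. The constant is
    [2048 = 4 * (8/3) * 16 * 12]. *)
Lemma ln_cgf_kernel_standard (s : R) : 64 * s ^+ 2 <= (1 - r) * H ->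
  `|ln (cgf_kernel A B (s / Num.sqrt (cgf_var A B))) - s ^+ 2 / 2| <=
    2048 * s ^+ 4 / (1 - r) ^+ 2 / H.
Proof.
move=> sH; set V := cgf_var A B; set t := s / _.
have V0 : 0 < V := cgf_var_gt0.
have QA0 := sum_sqrB1_gt0; have VQ := cgf_var_ge; rewrite -/V in VQ.
have d0 : 0 < 1 - r by rewrite subr_gt0.
have t2 : t ^+ 2 * V = s ^+ 2.
  rewrite /t expr_div_n sqr_sqrtr ?(ltW V0)//.
  by rewrite divfK// gt_eqF.
pose m : R := M%:R ^+ 2; have m0 : 0 <= m by exact: sqr_ge0.
have Hm : H * m <= 4 / 3 * QA by exact: max_sqr_le.
have Hd : 0 < (1 - r) * H by rewrite mulr_gt0.
have t20 : 0 <= t ^+ 2 by exact: sqr_ge0.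
(* [t ^+ 2 * (1 - r) * QA <= 12 * s ^+ 2] and [m <= 4 / 3 * QA / H] *)
have tm : t ^+ 2 * m * ((1 - r) * H) <= 16 * s ^+ 2.
  have e1 : t ^+ 2 * ((1 - r) * QA) <= t ^+ 2 * (12 * V) by exact: ler_wpM2l.
  have e2 : t ^+ 2 * (1 - r) * (H * m) <= t ^+ 2 * (1 - r) * (4 / 3 * QA).
    by apply: ler_wpM2l => //; rewrite mulr_ge0// ltW.
  have -> : t ^+ 2 * m * ((1 - r) * H) = t ^+ 2 * (1 - r) * (H * m) by ring.
  by apply: (le_trans e2); rewrite -t2; lra.
have tm4 : t ^+ 2 * m <= 4^-1.
  rewrite -(ler_pM2r Hd); apply: (le_trans tm); lra.
have tM : `|t| * M%:R <= 2^-1.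
  rewrite -(ler_pXn2r (_ : 0 < 2)%N) ?nnegrE ?mulr_ge0//.
  rewrite exprMn real_normK ?num_real// -/m (le_trans tm4)//.
  by rewrite exprVn -natrX.
have := ln_cgf_kernel A0 B0 AM denominator_le_max tM.
rewrite -/V (_ : V * t ^+ 2 = s ^+ 2); last by rewrite mulrC.
move=> /le_trans; apply.
rewrite !sum_sqr_size -sAB -/QA -/QB -/m.
(* [QB <= QA], and each size is at most [QA / 3]. *)
have S0 : QA + (size A)%:R + (QB + (size A)%:R) <= 8 / 3 * QA.
  have := size_le_third; have : QB <= QA; last by lra.
  exact: (le_trans QBr (ler_piMl (ltW QA0) (ltW r1))).
have t4 : t ^+ 4 = t ^+ 2 * t ^+ 2 by rewrite -exprD.
rewrite ler_pdivlMr// ler_pdivlMr ?exprn_gt0// t4.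
have e1 : t ^+ 2 * ((1 - r) * QA) <= 12 * s ^+ 2.
  have : t ^+ 2 * ((1 - r) * QA) <= t ^+ 2 * (12 * V) by exact: ler_wpM2l.
  by rewrite -t2; lra.
set S := _ + _ in S0 *.
apply: (@le_trans _ _ (32 / 3 * ((t ^+ 2 * m * ((1 - r) * H)) *
   (t ^+ 2 * ((1 - r) * QA))))).
  have -> : 4 * (t ^+ 2 * t ^+ 2) * m * S * H * (1 - r) ^+ 2 =
    (4 * (t ^+ 2 * t ^+ 2) * m * H * (1 - r) ^+ 2) * S by ring.
  have -> : 32 / 3 * ((t ^+ 2 * m * ((1 - r) * H)) * (t ^+ 2 * ((1 - r) * QA))) =
    (4 * (t ^+ 2 * t ^+ 2) * m * H * (1 - r) ^+ 2) * (8 / 3 * QA) by field.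
  apply: ler_wpM2l => //; apply: mulr_ge0; last exact: sqr_ge0.
  apply: mulr_ge0; last exact: ltW.
  by apply: mulr_ge0 => //; apply: mulr_ge0 => //; exact: mulr_ge0.
have -> : 2048 * s ^+ 4 = 32 / 3 * ((16 * s ^+ 2) * (12 * s ^+ 2)) by field.
apply: ler_wpM2l => //; apply: ler_pM => //.
- exact: (mulr_ge0 (mulr_ge0 t20 m0) (ltW Hd)).
- exact: (mulr_ge0 t20 (mulr_ge0 (ltW d0) (ltW QA0))).
Qed.

End single.

(** * Passage to the limit *)

Lemma limn_esup_lt1 (u : nat -> R) : (limn_esup (fun n => (u n)%:E) < 1)%E ->
  exists2 r : R, r < 1 & \forall n \near \oo, u n <= r.
Proof.
(* Some tail has supremum below 1. It bounds real values from above, so it is not [-oo], and it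
   serves as [r]. *)
rewrite /limn_esup limf_esupE => /ereal_inf_lt[_ [V [N _ NV] <-]] V1.
have le n : (N <= n)%N -> ((u n)%:E <= ereal_sup ((fun n => (u n)%:E) @` V))%E.
  by move=> Nn; apply: ereal_sup_ubound; exists n => //; exact: NV.
move: V1 le; case: (ereal_sup _) => [r|//|] r1 le.
- by exists r; [rewrite -lte_fin|exists N => // n /= Nn; rewrite -lee_fin le].
- by have := le N (leqnn N).
Qed.

End asymptotics.

(* [h1] says that trivial factors [1]_q = 1 common to the numerator and the
   denominator have been cancelled. Without it the result is false: take
   a N = {2, 1, ..., 1} and b N = {1, 1, ..., 1}, of size N + 1. *)
Theorem theorem1p5 (R : realType)
  (a b : nat -> {mset nat}%mset) (f : nat -> {poly int})
  (hf : forall N : nat, basic_cgf (a N) (b N) (f N))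
  (h1 : \forall N \near \oo, ~ (1%N \in a N /\ 1%N \in b N))
  (d : nat -> measure_display) (T : forall N : nat, measurableType (d N))
  (P : forall N : nat, probability (T N) R)
  (X : forall N : nat, {RV (P N) >-> R})
  (hX : forall N : nat, has_gen_fun (X N) (f N))
  (hlimsup : (limn_esup (fun N : nat =>
     ((\sum_(y <- b N) (y%:R ^+ 2 - 1 : R))
        / (\sum_(y <- a N) (y%:R ^+ 2 - 1 : R)))%:E) < 1)%E)
  (hlim : (fun N : nat =>
     \sum_(y <- a N) (y%:R / (\max_(z <- a N) z)%N%:R : R) ^+ 4) @ \oo --> +oo) :
  asymptotically_normal X.
Proof.
have [r r1 hr] := limn_esup_lt1 hlimsup.
pose V N : R := cgf_var (a N) (b N).
pose H N : R := \sum_(y <- a N) (y%:R / (\max_(z <- a N) z)%N%:R : R) ^+ 4.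
have Hgt c : \forall N \near \oo, c < H N by move/cvgryPgt : hlim; exact.
pose lnk N (s : R) := ln (cgf_kernel (a N) (b N) (s / Num.sqrt (V N))).
pose close N := forall s : R, 64 * s ^+ 2 <= (1 - r) * H N ->
  `|lnk N s - s ^+ 2 / 2| <= 2048 * s ^+ 4 / (1 - r) ^+ 2 / H N.
have [V0 cl] : (\forall N \near \oo, 0 < V N) /\ (\forall N \near \oo, close N).
  apply/near_andP.
  near=> N; have [/andP[A0 B0] sAB fAB _] := hf N.
  have n1 : ~ (1%N \in a N /\ 1%N \in b N) by near: N.
  have n2 : (\sum_(y <- b N) (y%:R ^+ 2 - 1 : R)) /
    (\sum_(y <- a N) (y%:R ^+ 2 - 1 : R)) <= r by near: N.
  have n3 : 0 < H N by near: N; exact: Hgt.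
  split; first exact: (cgf_var_gt0 A0 B0 fAB sAB n1 r1 n2 n3).
  by move=> s; exact: (ln_cgf_kernel_standard A0 B0 fAB sAB n1 r1 n2 n3).
split.
  near=> N; have [/andP[A0 B0] _ fAB _] := hf N.
  rewrite (cgf_moments A0 B0 fAB (hX N)).2 ltry andbT lte_fin.
  by near: N.
apply: (@cvg_mgf_normal _ _ _ _ _
  (fun N s => cgf_kernel (a N) (b N) (s / Num.sqrt (V N)))).
- move=> N; rewrite /standardize.
  by apply: measurable_funM => //; apply: measurable_funB.
(* This holds for every [N]: at variance 0 both quotients by the square root are 0 and both sides
   equal 1. *)
- move=> N t; have [/andP[A0 B0] _ fAB _] := hf N.
  exact: (cgf_standardize_mgf A0 B0 fAB (hX N)).
move=> s.
have lnK N t : expR (ln (cgf_kernel (a N) (b N) t)) = cgf_kernel (a N) (b N) t.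
  have [/andP[A0 B0] _ _ _] := hf N.
  by rewrite lnK// posrE cgf_kernel_gt0.
(* The convergence is proved for the logarithm of the kernel and carried over by continuity of
   [expR]. *)
under eq_fun do rewrite -lnK.
apply: (cvg_comp _ expR); last exact: continuous_expR.
apply/cvgrPdist_le => /= e e0.
pose c := 2048 * s ^+ 4 / (1 - r) ^+ 2.
have d0 : 0 < 1 - r by rewrite subr_gt0.
near=> N.
have gN : close N by near: N.
have n3 : 0 < H N by near: N; exact: Hgt.
(* [n4] makes the error [c / H N] smaller than [e], and [n5] is the range condition on [s] in
   [close]. *)
have n4 : c / e < H N by near: N; exact: Hgt.
have n5 : 64 * s ^+ 2 / (1 - r) < H N by near: N; exact: Hgt.
rewrite distrC (le_trans (gN s _))//.
  by rewrite [leRHS]mulrC -ler_pdivrMr// ltW.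
by rewrite ler_pdivrMr// [leRHS]mulrC -ler_pdivrMr// -/c ltW.
Unshelve. all: by end_near.
Qed.
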